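(* Let $\beta$ be an ordered partition of $N$ and suppose $\zeta\in(\mathfrak t')^*_\beta$ is $\beta$-generic with $\zeta(c)\ne0$. Then, as $\bar{\mathcal H}$-modules, $\mathcal Y_\beta(\zeta)=\bigoplus_{x\in X^\beta}\bar{\mathcal H}\cdot\varphi_x{\bf 1}_\zeta$, and for each $x\in X^\beta$ the summand $\bar{\mathcal H}\cdot\varphi_x{\bf 1}_\zeta$ is irreducible and isomorphic to $\bar{\mathcal Y}_{\beta(x)}(\overline{x(\zeta)})$ (via ${\bf 1}_{\overline{x(\zeta)}}\mapsto\varphi_x{\bf 1}_\zeta$), where $\overline{x(\zeta)}\in\bar{\mathfrak t}^*$ is the restriction of $x(\zeta)$ to $\bar{\mathfrak t}$.
   Context: Fix an integer $N\ge2$. Let $\bar{\mathfrak t}=\bigoplus_{i=1}^N\mathbb C\epsilon_i^\vee$, $\mathfrak t'=\bar{\mathfrak t}\oplus\mathbb Cc$, and let $\epsilon_1,\dots,\epsilon_N\in\bar{\mathfrak t}^*$ be the dual basis; regard $\bar{\mathfrak t}^*\subset(\mathfrak t')^*=\bar{\mathfrak t}^*\oplus\mathbb Cc^*$ with $\epsilon_i(c)=0$, $c^*(c)=1$, $c^*(\bar{\mathfrak t})=0$. Put $(\epsilon_i,\epsilon_j)=\delta_{ij}$ and, for $\zeta\in(\mathfrak t')^*$ and $\bar\alpha=\sum_ia_i\epsilon_i$, $(\zeta,\bar\alpha)=\sum_ia_i\zeta(\epsilon_i^\vee)$. Let $\bar R=\{\alpha_{ij}=\epsilon_i-\epsilon_j:i\ne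 j\}$, $\bar R_+=\{\alpha_{ij}:i<j\}$, $\alpha_i=\alpha_{i,i+1}$ ($1\le i\le N-1$), $\bar\Pi=\{\alpha_1,\dots,\alpha_{N-1}\}$. With a formal symbol $\delta$, the affine roots are $R=\{\bar\alpha+k\delta:\bar\alpha\in\bar R,k\in\mathbb Z\}$, $R_+=\{\bar\alpha+k\delta:\bar\alpha\in\bar R_+,k\ge0\}\cup\{-\bar\alpha+k\delta:\bar\alpha\in\bar R_+,k>0\}$, $R_-=R\setminus R_+$, and $\alpha_0=\delta-\alpha_{1N}$; indices $0,\dots,N-1$ are read modulo $N$. For $\alpha=\bar\alpha+k\delta\in R$ and $\zeta\in(\mathfrak t')^*$ set $(\zeta,\alpha)=(\zeta,\bar\alpha)+k\zeta(c)$; the coroot is $\alpha^\vee=\bar\alpha^\vee+kc\in\mathfrak t'$, where $(\epsilon_i-\epsilon_j)^\vee=\epsilon_i^\vee-\epsilon_j^\vee$, and $\alpha(\xi):=\bar\alpha(\xi)$ for $\xi\in\mathfrak t'$. Let $\bar P=\bigoplus_i\mathbb Z\epsilon_i$, $\bar P_-=\{\eta\in\bar P:(\eta,\alpha)\le0\ \forall\alpha\in\bar R_+\}$, $\bar W=\mathfrak S_N$ acting on indices ($w(\epsilon_i)=\epsilon_{w(i)}$, $w(\epsilon_i^\vee)=\epsilon^\vee_{w(i)}$, $w(c)=c$, $w(c^* )=c^*$), and $W=\bar W\ltimes\bar P$ with elements $wt_\eta$ and $wt_\eta w^{-1}=t_{w(\eta)}$. $W$ acts on $R$ by $w(\bar\alpha+k\delta)=w(\bar\alpha)+k\delta$,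 $t_\eta(\bar\alpha+k\delta)=\bar\alpha+(k-(\eta,\bar\alpha))\delta$; on $\mathfrak t'$ by $t_\eta(\xi)=\xi-\eta(\xi)c$; and on $(\mathfrak t')^*$ by the affine action $t_\eta(\zeta)=\zeta+\zeta(c)\eta$. For $\alpha=\bar\alpha+k\delta\in R$ let $s_\alpha=t_{-k\bar\alpha}s_{\bar\alpha}$, $s_i=s_{\alpha_i}$, $\pi=t_{\epsilon_1}s_1\cdots s_{N-1}$; $W$ is generated by $s_0,\dots,s_{N-1},\pi^{\pm1}$. $S(w)=R_+\cap w^{-1}(R_-)$, $l(w)=\#S(w)$, reduced expressions $w=\pi^ks_{j_1}\cdots s_{j_l}$ have $l=l(w)$. The degenerate double affine Hecke algebra $\mathcal H$ is the unital associative $\mathbb C$-algebra equal to $\mathbb C[W]\otimes S[\mathfrak t']$ as a vector space (via multiplication), in which $\mathbb C[W]$ and $S[\mathfrak t']$ are subalgebras and $s_i\xi-s_i(\xi)s_i=-\alpha_i(\xi)$ ($0\le i\le N-1$, $\xi\in\mathfrak t'$), $\pi\xi=\pi(\xi)\pi$. $\bar{\mathcal H}$ is the subalgebra generated by $\bar W$ and $\bar{\mathfrak t}$. Intertwiners: $\varphi_i=1+s_i\alpha_i^\vee$, $\varphi_\pi=\pi$, $\varphi_w=\varphi_\pi^k\varphi_{j_1}\cdots\varphi_{j_l}$ for a reduced expression $w=\pi^ks_{j_1}\cdots s_{j_l}$. An ordered partition $\gamma$ of $N$ gives blocks of consecutive indices of sizes $\gamma_1,\dots,\gamma_r$; $\bar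 R_\gamma=\{\alpha_{ij}:i,j\text{ in the same block}\}$, $\bar R_{\gamma,+}=\bar R_\gamma\cap\bar R_+$, $\bar\Pi_\gamma=\bar\Pi\cap\bar R_\gamma$, $\bar W_\gamma=\langle s_\alpha:\alpha\in\bar\Pi_\gamma\rangle$; $\mathcal H_\gamma$ (resp. $\bar{\mathcal H}_\gamma$) is the subalgebra generated by $S[\mathfrak t']$ (resp. $S[\bar{\mathfrak t}]$) and $\bar W_\gamma$. $(\mathfrak t')^*_\gamma=\{\zeta\in(\mathfrak t')^*:(\zeta,\alpha)=-1\ \forall\alpha\in\bar\Pi_\gamma\}$, and $\bar{\mathfrak t}^*_\gamma$ analogously in $\bar{\mathfrak t}^*$. For such $\zeta$, $\mathbb C1_\zeta$ is the one-dimensional module with $w1_\zeta=1_\zeta$ ($w\in\bar W_\gamma$), $\xi1_\zeta=\zeta(\xi)1_\zeta$; $\mathcal Y_\gamma(\zeta)=\mathcal H\otimes_{\mathcal H_\gamma}\mathbb C1_\zeta$, $\bar{\mathcal Y}_\gamma(\zeta)=\bar{\mathcal H}\otimes_{\bar{\mathcal H}_\gamma}\mathbb C1_\zeta$, with cyclic vector ${\bf 1}_\zeta=1\otimes1_\zeta$. $W^\gamma=\{w\in W:l(wu)\ge l(w)\ \forall u\in\bar W_\gamma\}$, $\bar W^\gamma=W^\gamma\cap\bar W$. A weight $\zeta\in(\mathfrak t')^*_\gamma$ is $\gamma$-generic if $(\zeta,\alpha)\notin\{1,0,-1\}$ for all $\alpha\in R_+\setminus\bar R_{\gamma,+}$.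 For $w\in W$, $\beta(w)$ is the ordered partition of $N$ with $\bar\Pi_{\beta(w)}=\bar\Pi\cap w(\bar R_{\beta,+})$. For $w\in\bar W^\beta$, $\eta_w\in\bar P_-$ is defined by $(\eta_w,\epsilon_1)=0$ and $(\eta_w,\alpha_i)=-1$ if $\alpha_i\in w(\bar R_+\setminus\bar R_{\beta,+})$, $0$ otherwise; $\bar P_-(w)=\{\eta+\eta_w:\eta\in\bar P_-\}$; $X^\beta=\{t_\eta w:w\in\bar W^\beta,\eta\in\bar P_-(w)\}$. *)

(* Defs.v *)
(* Degenerate DAHA of type GL_N, encoded via modules
   (operations on a vector space satisfying the defining relations). *)
From HB Require Import structures.
From mathcomp Require Import all_boot all_order all_algebra all_fingroup.
Set Implicit Arguments. Unset Strict Implicit. Unset Printing Implicit Defensive.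
Import GRing.Theory Num.Theory.
Local Open Scope ring_scope.

(* Indices: 'I_N, 0-based.  Paper index p (1..N) is position p-1.       *)
(* Simple roots alpha_i, i : 'I_N, i = 0 .. N-1 (paper's indices).      *)
(*   for i <> 0 : alpha_i = eps_{i-1} - eps_i (0-based positions)       *)
(*   alpha_0    = delta - (eps_0 - eps_{N-1})                           *)

Lemma prev_lt {N} (i : 'I_N) : (i.-1 < N)%N.
Proof. exact: leq_ltn_trans (leq_pred i) (ltn_ord i). Qed.
Definition prevo {N} (i : 'I_N) : 'I_N := Ordinal (prev_lt i).

Lemma last_lt {N} (i : 'I_N) : (N.-1 < N)%N.
Proof. by case: N i => [[m]|n _] //=; rewrite ltnSn. Qed.
Definition lasto {N} (i : 'I_N) : 'I_N := Ordinal (last_lt i).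

Lemma first_lt {N} (i : 'I_N) : (0 < N)%N.
Proof. exact: leq_ltn_trans (leq0n i) (ltn_ord i). Qed.
Definition firsto {N} (i : 'I_N) : 'I_N := Ordinal (first_lt i).

(* Extended affine Weyl group W = S_N |x P.                             *)
(* The pair (u, eta) stands for t_eta u.                                *)
(* Note: in mathcomp (s * t)%g x = t (s x), so u o v = (v * u)%g.       *)
Definition W (N : nat) := ('S_N * {ffun 'I_N -> int})%type.

Definition wone {N} : W N := (1%g, [ffun => 0]).
Definition wmul {N} (x y : W N) : W N :=
  ((y.1 * x.1)%g, [ffun j => x.2 j + y.2 ((x.1)^-1%g j)]).
Definition winv {N} (x : W N) : W N :=
  ((x.1)^-1%g, [ffun j => - x.2 (x.1 j)]).
Definition wpowz {N} (x : W N) (k : int) : W N :=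
  match k with
  | Posz n => iter n (wmul x) wone
  | Negz n => iter n.+1 (wmul (winv x)) wone
  end.

(* generators s_0, ..., s_{N-1};  s_0 = s_{alpha_0} = t_{eps_1 - eps_N} s_{alpha_{1N}} *)
Definition sgen {N} (i : 'I_N) : W N :=
  if val i == 0%N then
    (tperm (firsto i) (lasto i),
     [ffun j => (nat_of_bool (val j == 0%N))%:Z - (nat_of_bool (val j == N.-1))%:Z])
  else (tperm (prevo i) i, [ffun => 0]).

(* pi = t_{eps_1} s_1 ... s_{N-1}; s_1...s_{N-1} is the cyclic shift j -> j+1 mod N *)
Definition cshift {N} : 'S_N := perm (@ordS_inj N).
Definition piW {N} : W N := (cshift, [ffun j => (nat_of_bool (val j == 0%N))%:Z]).

(* Affine roots  eps_a - eps_b + k delta  (a <> b) as triples (a,b,k).  *)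
Definition wroot {N} (w : W N) (a b : 'I_N) (k : int) : 'I_N * 'I_N * int :=
  (w.1 a, w.1 b, k - (w.2 (w.1 a) - w.2 (w.1 b))).

Definition rootpos {N} (a b : 'I_N) (k : int) : bool :=
  ((val a < val b)%N && (0 <= k)) || ((val b < val a)%N && (0 < k)).
Definition rootneg {N} (a b : 'I_N) (k : int) : bool := (a != b) && ~~ rootpos a b k.

Definition inS {N} (w : W N) (a b : 'I_N) (k : int) : bool :=
  [&& a != b, rootpos a b k & (let r := wroot w a b k in rootneg r.1.1 r.1.2 r.2)].

(* every element of S(w) has 0 <= k <= lbound w (since k <= eta_{ua} - eta_{ub}),
   so l(w) = #S(w) is the following finite count. *)
Definition lbound {N} (w : W N) : nat := (\sum_(j < N) `|w.2 j|)%N.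
Definition wlength {N} (w : W N) : nat :=
  (\sum_(a < N) \sum_(b < N) \sum_(k < (lbound w).+1) nat_of_bool (inS w a b k%:Z))%N.

(* A subset of \bar\Pi is encoded as a selector sel : 'I_N -> bool       *)
(* (alpha_i \in \bar\Pi_gamma iff i <> 0 and sel i).                     *)
Definition is_composition (N : nat) (g : seq nat) : Prop :=
  all (fun p => (0 < p)%N) g /\ sumn g = N.

(* block number of the 0-based position p *)
Definition blk (g : seq nat) (p : nat) : nat :=
  (\sum_(k < size g) nat_of_bool (\sum_(l < k.+1) nth 0%N g l <= p))%N.

Definition selP {N} (g : seq nat) : 'I_N -> bool :=
  fun i => (val i != 0%N) && (blk g i.-1 == blk g i).

Definition sameblk {N} (sel : 'I_N -> bool) (a b : 'I_N) : bool :=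
  [forall i : 'I_N, ((minn a b < i) && (i <= maxn a b))%N ==> sel i].

Definition inRgp {N} (sel : 'I_N -> bool) (a b : 'I_N) (k : int) : bool :=
  [&& k == 0, (val a < val b)%N & sameblk sel a b].

Definition in_Wbar_gamma {N} (sel : 'I_N -> bool) (w : W N) : Prop :=
  exists js : seq 'I_N, all (fun i => (val i != 0%N) && sel i) js /\
                        w = foldr wmul wone (map sgen js).

Definition in_Wsup {N} (sel : 'I_N -> bool) (w : W N) : Prop :=
  forall u, in_Wbar_gamma sel u -> (wlength w <= wlength (wmul w u))%N.
Definition in_Wbarsup {N} (sel : 'I_N -> bool) (w : W N) : Prop :=
  in_Wsup sel w /\ w.2 = [ffun => 0].

Definition is_dom {N} (eta : {ffun 'I_N -> int}) : Prop :=
  forall a b : 'I_N, (val a < val b)%N -> eta a <= eta b.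

Definition is_eta_w {N} (sel : 'I_N -> bool) (u : 'S_N) (eta : {ffun 'I_N -> int}) : Prop :=
  (forall i : 'I_N, val i = 0%N -> eta i = 0) /\
  (forall i : 'I_N, val i != 0%N ->
     eta (prevo i) - eta i =
       if [exists a : 'I_N, exists b : 'I_N,
             [&& (val a < val b)%N, ~~ sameblk sel a b, u a == prevo i & u b == i]]
       then -1 else 0).

Definition in_X {N} (sel : 'I_N -> bool) (x : W N) : Prop :=
  exists (u : 'S_N) (eta0 etaw : {ffun 'I_N -> int}),
    [/\ in_Wbarsup sel (u, [ffun => 0]), is_dom eta0, is_eta_w sel u etaw &
        x = (u, [ffun j => eta0 j + etaw j])].

(* beta(w): \bar\Pi_{beta(w)} = \bar\Pi \cap w(\bar R_{beta,+}) *)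
Definition selB {N} (sel : 'I_N -> bool) (w : W N) : 'I_N -> bool :=
  fun i => (val i != 0%N) &&
    [exists a : 'I_N, exists b : 'I_N,
       inRgp sel a b 0 && (wroot w a b 0 == (prevo i, i, 0))].

(* t' = \bar t + C c and its dual, over a field F.                      *)
(* xi = (x, xc) means sum_i x_i eps_i^vee + xc c;                       *)
(* zeta = (z, zc) means sum_i z_i eps_i + zc c^*.                       *)
Definition tvec (F : numClosedFieldType) N := ({ffun 'I_N -> F} * F)%type.
Definition tdual (F : numClosedFieldType) N := ({ffun 'I_N -> F} * F)%type.

Definition wact_t {F : numClosedFieldType} {N} (w : W N) (xi : tvec F N) : tvec F N :=
  let ux := [ffun j => xi.1 ((w.1)^-1%g j)] in
  (ux, xi.2 - \sum_(j < N) (w.2 j)%:~R * ux j).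

Definition wact_dual {F : numClosedFieldType} {N} (w : W N) (z : tdual F N) : tdual F N :=
  ([ffun j => z.1 ((w.1)^-1%g j) + z.2 * (w.2 j)%:~R], z.2).

Definition pair_root {F : numClosedFieldType} {N} (z : tdual F N) (a b : 'I_N) (k : int) : F :=
  z.1 a - z.1 b + k%:~R * z.2.

Definition alpha_of {F : numClosedFieldType} {N} (i : 'I_N) (xi : tvec F N) : F :=
  if val i == 0%N then xi.1 (lasto i) - xi.1 (firsto i) else xi.1 (prevo i) - xi.1 i.

Definition coroot {F : numClosedFieldType} {N} (i : 'I_N) : tvec F N :=
  if val i == 0%N then
    ([ffun j => (j == lasto i)%:R - (j == firsto i)%:R], 1)
  else ([ffun j => (j == prevo i)%:R - (j == i)%:R], 0).

Definition in_tdual_gamma {F : numClosedFieldType} {N} (sel : 'I_N -> bool) (z : tdual F N) : Prop :=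
  forall i : 'I_N, val i != 0%N -> sel i -> z.1 (prevo i) - z.1 i = -1.

Definition generic {F : numClosedFieldType} {N} (sel : 'I_N -> bool) (z : tdual F N) : Prop :=
  forall (a b : 'I_N) (k : int), a != b -> rootpos a b k -> ~~ inRgp sel a b k ->
    ~ (pair_root z a b k = 1 \/ pair_root z a b k = 0 \/ pair_root z a b k = -1).

(* Modules.  An H-module is a vector space with operators for W, for   *)
(* the basis eps_i^vee of \bar t and for c, satisfying the defining     *)
(* relations of H; likewise for \bar H (generated by \bar W, \bar t).    *)
Record Hops (F : numClosedFieldType) (N : nat) (V : lmodType F) := HOps {
  hW : W N -> V -> V; hX : 'I_N -> V -> V; hC : V -> V }.
Record Bops (F : numClosedFieldType) (N : nat) (V : lmodType F) := BOps {
  bW : 'S_N -> V -> V; bX : 'I_N -> V -> V }.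

Arguments Hops : clear implicits.
Arguments Bops : clear implicits.

Definition lin {F : numClosedFieldType} {V U : lmodType F} (f : V -> U) : Prop :=
  forall (a : F) (u v : V), f (a *: u + v) = a *: f u + f v.

Definition actT {F : numClosedFieldType} {N : nat} {V : lmodType F} (M : Hops F N V) (xi : tvec F N) (v : V) : V :=
  \sum_(i < N) xi.1 i *: hX M i v + xi.2 *: hC M v.
Definition actTb {F : numClosedFieldType} {N : nat} {V : lmodType F} (B : Bops F N V) (xi : {ffun 'I_N -> F}) (v : V) : V :=
  \sum_(i < N) xi i *: bX B i v.

Definition is_Hmod {F : numClosedFieldType} {N : nat} {V : lmodType F} (M : Hops F N V) : Prop :=
  [/\ (forall x, lin (hW M x)) /\ (forall i, lin (hX M i)) /\ lin (hC M),
      (forall v, hW M wone v = v) /\ (forall x y v, hW M (wmul x y) v = hW M x (hW M y v)),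
      (forall i j v, hX M i (hX M j v) = hX M j (hX M i v)) /\
      (forall i v, hX M i (hC M v) = hC M (hX M i v)),
      (forall i xi v, hW M (sgen i) (actT M xi v) - actT M (wact_t (sgen i) xi) (hW M (sgen i) v)
                      = - alpha_of i xi *: v)
    & (forall xi v, hW M piW (actT M xi v) = actT M (wact_t piW xi) (hW M piW v))].

Definition is_Bmod {F : numClosedFieldType} {N : nat} {V : lmodType F} (B : Bops F N V) : Prop :=
  [/\ (forall u, lin (bW B u)) /\ (forall i, lin (bX B i)),
      (forall v, bW B 1%g v = v) /\ (forall u u' v, bW B (u' * u)%g v = bW B u (bW B u' v)),
      (forall i j v, bX B i (bX B j v) = bX B j (bX B i v))
    & (forall (i : 'I_N) xi v, val i != 0%N ->
         bW B (tperm (prevo i) i) (actTb B xi v)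
         - actTb B [ffun j => xi ((tperm (prevo i) i)^-1%g j)] (bW B (tperm (prevo i) i) v)
         = - (xi (prevo i) - xi i) *: v)].

Definition resB {F : numClosedFieldType} {N : nat} {V : lmodType F} (M : Hops F N V) : Bops F N V :=
  BOps (fun u => hW M (u, [ffun => 0])) (hX M).

Definition equivH {F : numClosedFieldType} {N : nat} {V U : lmodType F} (M : Hops F N V) (MU : Hops F N U) (f : V -> U) : Prop :=
  [/\ forall x v, f (hW M x v) = hW MU x (f v),
      forall i v, f (hX M i v) = hX MU i (f v)
    & forall v, f (hC M v) = hC MU (f v)].
Definition equivB {F : numClosedFieldType} {N : nat} {V U : lmodType F} (B : Bops F N V) (BU : Bops F N U) (f : V -> U) : Prop :=
  (forall u v, f (bW B u v) = bW BU u (f v)) /\ (forall i v, f (bX B i v) = bX BU i (f v)).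

Inductive Hgen {F : numClosedFieldType} {N : nat} {V : lmodType F} (M : Hops F N V) (v0 : V) : V -> Prop :=
| Hg_base : Hgen M v0 v0
| Hg_zero : Hgen M v0 0
| Hg_add u w : Hgen M v0 u -> Hgen M v0 w -> Hgen M v0 (u + w)
| Hg_scale a u : Hgen M v0 u -> Hgen M v0 (a *: u)
| Hg_W x u : Hgen M v0 u -> Hgen M v0 (hW M x u)
| Hg_X i u : Hgen M v0 u -> Hgen M v0 (hX M i u)
| Hg_C u : Hgen M v0 u -> Hgen M v0 (hC M u).

Inductive Bgen {F : numClosedFieldType} {N : nat} {V : lmodType F} (B : Bops F N V) (v0 : V) : V -> Prop :=
| Bg_base : Bgen B v0 v0
| Bg_zero : Bgen B v0 0
| Bg_add u w : Bgen B v0 u -> Bgen B v0 w -> Bgen B v0 (u + w)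
| Bg_scale a u : Bgen B v0 u -> Bgen B v0 (a *: u)
| Bg_W s u : Bgen B v0 u -> Bgen B v0 (bW B s u)
| Bg_X i u : Bgen B v0 u -> Bgen B v0 (bX B i u).

Definition is_Bsub {F : numClosedFieldType} {N : nat} {V : lmodType F} (B : Bops F N V) (P : V -> Prop) : Prop :=
  [/\ P 0, (forall u w, P u -> P w -> P (u + w)), (forall a u, P u -> P (a *: u)),
      (forall s u, P u -> P (bW B s u)) & (forall i u, P u -> P (bX B i u))].

Definition Birreducible {F : numClosedFieldType} {N : nat} {V : lmodType F} (B : Bops F N V) (P : V -> Prop) : Prop :=
  (exists v, P v /\ v <> 0) /\
  forall Q : V -> Prop, is_Bsub B Q -> (forall v, Q v -> P v) ->
    (forall v, Q v -> v = 0) \/ (forall v, P v -> Q v).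

Definition relH {F : numClosedFieldType} {N : nat} {V : lmodType F} (sel : 'I_N -> bool) (z : tdual F N) (M : Hops F N V) (v : V) : Prop :=
  [/\ forall w, in_Wbar_gamma sel w -> hW M w v = v,
      forall i, hX M i v = z.1 i *: v
    & hC M v = z.2 *: v].
Definition relB {F : numClosedFieldType} {N : nat} {V : lmodType F} (sel : 'I_N -> bool) (z : {ffun 'I_N -> F}) (B : Bops F N V) (v : V) : Prop :=
  (forall u : 'S_N, in_Wbar_gamma sel (u, [ffun => 0]) -> bW B u v = v) /\
  (forall i, bX B i v = z i *: v).

(* (V, M, one) is (a model of) the induced module
   Y_gamma(zeta) = H \otimes_{H_gamma} C 1_zeta with 1_zeta = one,
   characterized by its universal property. *)
Definition is_induced_H {F : numClosedFieldType} {N : nat} {V : lmodType F} (sel : 'I_N -> bool) (z : tdual F N)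
  (M : Hops F N V) (one : V) : Prop :=
  [/\ is_Hmod M, relH sel z M one, (forall v, Hgen M one v)
    & forall (U : lmodType F) (MU : Hops F N U) (u : U), is_Hmod MU -> relH sel z MU u ->
        exists f : V -> U, [/\ lin f, equivH M MU f & f one = u]].

(* (V, B, one) is (a model of) \bar Y_gamma(z) = \bar H \otimes_{\bar H_gamma} C 1_z *)
Definition is_induced_B {F : numClosedFieldType} {N : nat} {V : lmodType F} (sel : 'I_N -> bool) (z : {ffun 'I_N -> F})
  (B : Bops F N V) (one : V) : Prop :=
  [/\ is_Bmod B, relB sel z B one, (forall v, Bgen B one v)
    & forall (U : lmodType F) (BU : Bops F N U) (u : U), is_Bmod BU -> relB sel z BU u ->
        exists f : V -> U, [/\ lin f, equivB B BU f & f one = u]].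

Definition phi_gen {F : numClosedFieldType} {N : nat} {V : lmodType F} (M : Hops F N V) (i : 'I_N) (v : V) : V :=
  v + hW M (sgen i) (actT M (coroot i) v).

Definition is_red {N} (w : W N) (r : int * seq 'I_N) : Prop :=
  w = wmul (wpowz piW r.1) (foldr wmul wone (map sgen r.2)) /\ size r.2 = wlength w.

Definition phi_red {F : numClosedFieldType} {N : nat} {V : lmodType F} (M : Hops F N V) (r : int * seq 'I_N) (v : V) : V :=
  hW M (wpowz piW r.1) (foldr (phi_gen M) v r.2).

(* Main.v *)
Require Import Defs.
From HB Require Import structures.
From mathcomp Require Import all_boot all_order all_algebra all_fingroup.
From mathcomp Require Import zify ring.
From mathcomp Require Import finmap.
From mathcomp.multinomials Require Import monalg.
From Stdlib Require Import Classical.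
Set Implicit Arguments. Unset Strict Implicit. Unset Printing Implicit Defensive.
Import Order.TTheory GRing.Theory Num.Theory.
Local Open Scope ring_scope.

(** Because [zeta] is generic, its stabilizer in W is trivial, and [(zeta, alpha)] is [1] or [-1]
    only for roots alpha of the blocks. On a vector of weight mu the intertwiner phi_i squares to
    [1 - (mu, alpha_i)^2], so it can be inverted unless [(mu, alpha_i)] is [1] or [-1].

    The vectors w.1 are triangular for the length under the action of t', and w.1 only depends on
    the coset of w, so the only weights of Y_beta(zeta) are the w(zeta) with w minimal in its coset,
    and each of them is simple. Hence phi_i kills the vector of weight w(zeta) as soon as
    s_i w is not minimal, which replaces any appeal to the independence of phi_w from the reduced
    word. It follows that Y_beta(zeta) is spanned by the vectors obtained from 1 by invertible
    intertwiners, and that a nonzero submodule contains 1.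

    The same argument applies to \bar H: every minimal w can be moved by invertible finite
    intertwiners to the unique x in its \bar W-orbit whose positions j are sorted by the triple
    (eta_j, - block of u^{-1} j, u^{-1} j), where x = t_eta u, and these x form X^beta. So
    Y_beta(zeta) is the sum of the \bar H.phi_x 1, which are irreducible with pairwise disjoint sets
    of weights.

    All of this collapses if 1 = 0; that it does not is shown on the explicit module C[W], with t'
    acting by Dunkl operators, where the sum of the elements of \bar W_beta satisfies the defining
    relations of 1_zeta. *)

(** * The extended affine Weyl group *)

(** The module is known only through its generator and its universal property: no basis of
    Y_beta(zeta) or of \bar Y is at hand, and no dimension can be counted. Three devices replace a
    basis. Spans are impredicative, so a property reaches the whole module once it defines a
    subspace and holds on generators. A vector has no weight decomposition a priori; instead, a
    product of operators X_i - c that is a nonzero scalar on a prescribed weight pushes it into a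
    small subspace ([carried]). Injectivity and directness come from irreducibility: a kernel, or
    the intersection of one summand with the sum of the others, would contain the generator if it
    were nonzero.

    The switch [full] makes one development serve twice: for W at the weight zeta, and for \bar W at
    the weight x(zeta) with cyclic vector phi_x 1. The second use can only ask for genericity on
    finite roots, because x may carry a block root to a root with a nonzero multiple of delta, which
    stays resonant for x(zeta) and lies outside beta(x). *)

Section WeylGroup.
Variable N : nat.
Implicit Types (x y w : W N) (i j a b : 'I_N).

Lemma W_eqP x y : x.1 = y.1 -> (forall j, x.2 j = y.2 j) -> x = y.
Proof. by case: x y => [u e] [v f] /= -> h; congr pair; apply/ffunP. Qed.

Lemma wmulA x y w : wmul x (wmul y w) = wmul (wmul x y) w.
Proof.
by apply: W_eqP => [|j]; rewrite /= ?mulgA // !ffunE /= addrA invMg permM.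
Qed.

Lemma wmul1w x : wmul wone x = x.
Proof. by apply: W_eqP => [|j]; rewrite /= ?mulg1 // !ffunE add0r invg1 perm1. Qed.

Lemma wmulw1 x : wmul x wone = x.
Proof. by apply: W_eqP => [|j]; rewrite /= ?mul1g // !ffunE addr0. Qed.

Lemma wmulVw x : wmul (winv x) x = wone.
Proof. by apply: W_eqP => [|j]; rewrite /= ?mulgV // !ffunE /= invgK addNr. Qed.

Lemma wmulwV x : wmul x (winv x) = wone.
Proof. by apply: W_eqP => [|j]; rewrite /= ?mulVg // !ffunE /= permKV subrr. Qed.

Lemma wmulKw x y : wmul (winv x) (wmul x y) = y.
Proof. by rewrite wmulA wmulVw wmul1w. Qed.

Lemma wmulVKw x y : wmul x (wmul (winv x) y) = y.
Proof. by rewrite wmulA wmulwV wmul1w. Qed.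

Lemma winvM x y : winv (wmul x y) = wmul (winv y) (winv x).
Proof.
by rewrite -[RHS](wmulKw (wmul x y)) -(wmulA x y) wmulVKw wmulwV wmulw1.
Qed.

Lemma winv1 : winv wone = wone :> W N.
Proof. by rewrite -[LHS]wmul1w wmulwV. Qed.

Definition aroot := ('I_N * 'I_N * int)%type.
Implicit Types r : aroot.
Definition wr w r : aroot := wroot w r.1.1 r.1.2 r.2.
Definition rpos r : bool := rootpos r.1.1 r.1.2 r.2.
Definition isroot r : bool := r.1.1 != r.1.2.
Definition ropp r : aroot := (r.1.2, r.1.1, - r.2).
Definition sroot i : aroot :=
  if val i == 0%N then (lasto i, firsto i, 1) else (prevo i, i, 0).

Lemma wrM x y r : wr (wmul x y) r = wr x (wr y r).
Proof.
by case: r => [[a b] k]; rewrite /wr /wroot /= !ffunE /= !permM !permK; congr (_, _, _); ring.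
Qed.

Lemma wr1 r : wr wone r = r.
Proof. by case: r => [[a b] k]; rewrite /wr /wroot /= !ffunE /= !perm1; congr (_, _, _); ring. Qed.

Lemma wrK w : cancel (wr w) (wr (winv w)).
Proof. by move=> r; rewrite -wrM wmulVw wr1. Qed.

Lemma wrVK w : cancel (wr (winv w)) (wr w).
Proof. by move=> r; rewrite -wrM wmulwV wr1. Qed.

Lemma wr_inj w : injective (wr w).
Proof. exact: can_inj (wrK w). Qed.

Lemma wr_isroot w r : isroot (wr w r) = isroot r.
Proof. by rewrite /isroot /= (inj_eq perm_inj). Qed.

Lemma ropp_isroot r : isroot (ropp r) = isroot r.
Proof. by rewrite /isroot eq_sym. Qed.

Lemma roppK : involutive ropp.
Proof. by case=> [[a b] k]; rewrite /ropp /= opprK. Qed.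

Lemma wr_opp w r : wr w (ropp r) = ropp (wr w r).
Proof. by rewrite /wr /wroot /ropp /=; congr (_, _, _); ring. Qed.

Lemma rpos_opp r : isroot r -> rpos (ropp r) = ~~ rpos r.
Proof.
case: r => [[a b] k]; rewrite /isroot /rpos /rootpos /= => ab.
by move: ab; rewrite -val_eqE /=; move: (nat_of_ord a) (nat_of_ord b) => m n; lia.
Qed.

Hypothesis N2 : (2 <= N)%N.

Lemma sroot_isroot i : isroot (sroot i).
Proof. by rewrite /sroot /isroot; case: ifP => h; rewrite -val_eqE /=; move: h => /=; lia. Qed.

Lemma sroot_pos i : rpos (sroot i).
Proof. by rewrite /sroot /rpos /rootpos; case: ifP; case: i => /= *; lia. Qed.

Lemma tpermEv a b j : val (tperm a b j) =
  if val j == val a then val b else if val j == val b then val a else val j.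
Proof. by rewrite permE /= -!val_eqE; case: ifP => //; case: ifP. Qed.

Lemma tperm_val a b j : let t := val (tperm a b j) in
  [|| (val j == val a) && (t == val b), (val j == val b) && (t == val a) |
     [&& val j != val a, val j != val b & t == val j]].
Proof. by move=> /=; rewrite tpermEv; case: ifP => [/eqP->|]; [|case: ifP => [/eqP->|]]; rewrite ?eqxx ?orbT. Qed.

Lemma wr_sroot i : wr (sgen i) (sroot i) = ropp (sroot i).
Proof.
rewrite /wr /wroot /sroot /sgen /ropp; case: ifP => h /=; last by rewrite tpermL tpermR !ffunE.
by rewrite tpermL tpermR !ffunE /=; congr (_, _, _); lia.
Qed.

Lemma rpos_sgen i r : isroot r -> rpos r -> r != sroot i -> rpos (wr (sgen i) r).
Proof.
case: r => [[a b] k]; rewrite /isroot /sroot /wr /wroot /sgen /rpos /rootpos /= => ab pr.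
case: ifP => i0; rewrite !xpair_eqE /= -!val_eqE /= => ne; rewrite ?ffunE.
- have := tperm_val (firsto i) (lasto i) a; have := tperm_val (firsto i) (lasto i) b.
  move: ab pr ne i0 => /=; rewrite -!val_eqE /=.
  move: (val (tperm _ _ a)) (val (tperm _ _ b)) => ta tb.
  by move: (ltn_ord a) (ltn_ord b); move: (nat_of_ord a) (nat_of_ord b) => {a b} m n; lia.
- have := tperm_val (prevo i) i a; have := tperm_val (prevo i) i b.
  move: ab pr ne i0 => /=; rewrite -!val_eqE /=.
  move: (val (tperm _ _ a)) (val (tperm _ _ b)) => ta tb.
  by move: (nat_of_ord a) (nat_of_ord b) (nat_of_ord i) => {a b i} m n p; lia.
Qed.

Lemma sgenK i : wmul (sgen i) (sgen i) = wone.
Proof.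
apply: W_eqP => [|j]; first by rewrite /sgen; case: ifP => _ /=; rewrite tperm2.
rewrite /sgen; case: ifP => h /=; rewrite !ffunE //= tpermV.
have := tperm_val (firsto i) (lasto i) j => /=.
move: (val (tperm _ _ j)) => t; move: (ltn_ord j); move: (nat_of_ord j) => m; lia.
Qed.

Lemma wmulsK i w : wmul (sgen i) (wmul (sgen i) w) = w.
Proof. by rewrite wmulA sgenK wmul1w. Qed.

Lemma winv_sgen i : winv (sgen i) = sgen i.
Proof. by rewrite -[LHS]wmulw1 -(sgenK i) wmulKw. Qed.

Lemma cshift_val a : val (cshift a) = if val a == N.-1 then 0%N else (val a).+1.
Proof.
rewrite /cshift permE /= /ordS /=; case: ifP => h; first by rewrite (eqP h) prednK ?modnn //; lia.
by rewrite modn_small //; have := ltn_ord a; move: h => /=; lia.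
Qed.

Lemma rpos_pi r : rpos (wr piW r) = rpos r.
Proof.
case: r => [[a b] k]; rewrite /wr /wroot /piW /rpos /rootpos /= !ffunE.
rewrite !cshift_val /=; move: (ltn_ord a) (ltn_ord b).
by move: (nat_of_ord a) (nat_of_ord b) => m n; case: (m =P N.-1); case: (n =P N.-1) => /=; lia.
Qed.

Lemma rpos_piV r : rpos (wr (winv piW) r) = rpos r.
Proof. by rewrite -rpos_pi wrVK. Qed.

Lemma rpos_pow k r : rpos (wr (wpowz piW k) r) = rpos r.
Proof.
case: k => n; rewrite /wpowz.
- by elim: n r => [|n IH] r /=; rewrite ?wr1 // wrM rpos_pi.
- by elim: n.+1 r => [|m IH] r /=; rewrite ?wr1 // wrM rpos_piV.
Qed.

Lemma inSE w r : inS w r.1.1 r.1.2 r.2 = [&& isroot r, rpos r & ~~ rpos (wr w r)].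
Proof.
rewrite /inS /rootneg -/(wr w r) -/(rpos r) -/(rpos (wr w r)) -/(isroot r) -/(isroot (wr w r)).
by rewrite wr_isroot; case: (isroot r).
Qed.

Definition Slist w : seq aroot :=
  [seq r <- [seq (p.1.1, p.1.2, (val p.2)%:Z) | p <- enum [set: 'I_N * 'I_N * 'I_(lbound w).+1]]
     | inS w r.1.1 r.1.2 r.2].

Lemma Slist_uniq w : uniq (Slist w).
Proof.
apply: filter_uniq; rewrite map_inj_uniq ?enum_uniq //.
by move=> [[a b] k] [[a' b'] k'] /= [-> -> /val_inj ->].
Qed.

Lemma lbound_ge w a b : a != b -> (`|w.2 a| + `|w.2 b| <= lbound w)%N.
Proof.
move=> ab; rewrite /lbound (bigD1 a) //= (bigD1 b) /=; last by rewrite eq_sym.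
by rewrite addnA leq_addr.
Qed.

(** The enumeration misses no inversion: if w makes a positive root negative, its k is at most a
    difference of two translation coordinates of w, hence at most [lbound w]. *)
Lemma mem_Slist w r : (r \in Slist w) = [&& isroot r, rpos r & ~~ rpos (wr w r)].
Proof.
clear N2; rewrite mem_filter inSE andb_idr // => /and3P[ir pr nr].
case: r ir pr nr => [[a b] k] ir pr nr.
have uab : w.1 a != w.1 b by rewrite (inj_eq perm_inj).
have := lbound_ge w uab; move: nr pr; rewrite /rpos /rootpos /wr /wroot /= => nr pr hl.
have k0 : 0 <= k by lia.
have kl : (`|k| < (lbound w).+1)%N.
  move: (w.2 _) (w.2 _) uab nr hl => p q; rewrite -val_eqE /=.
  by move: (nat_of_ord (w.1 a)) (nat_of_ord (w.1 b)) (nat_of_ord a) (nat_of_ord b) pr => ????; lia.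
apply/mapP; exists (a, b, Ordinal kl); first by rewrite mem_enum inE.
by rewrite /= gez0_abs.
Qed.

Lemma wlength_size w : wlength w = size (Slist w).
Proof.
rewrite /Slist size_filter count_map -sum1_count big_mkcond /= big_enum_cond /=.
rewrite /wlength pair_bigA /= pair_bigA /=.
by apply: eq_big => [p|p _]; rewrite ?inE //=; case: ifP.
Qed.

Lemma wlength_sgen_sub i w r :
  r \in Slist (wmul (sgen i) w) -> r = wr (winv w) (sroot i) \/ r \in Slist w.
Proof.
rewrite !mem_Slist wrM => /and3P[ir pr]; rewrite ir pr /=.
case pw: (rpos (wr w r)); last by right.
have [/eqP/(canRL (wrK w))-> _|ne] := boolP (wr w r == sroot i); first by left.
by rewrite rpos_sgen ?wr_isroot.
Qed.

Lemma wlength_sgen_le i w : (wlength (wmul (sgen i) w) <= (wlength w).+1)%N.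
Proof.
rewrite !wlength_size; apply: (@uniq_leq_size _ _ (wr (winv w) (sroot i) :: Slist w)) => [|r].
  exact: Slist_uniq.
by rewrite inE => /wlength_sgen_sub[->|->]; rewrite ?eqxx ?orbT.
Qed.

(** The root -w^{-1}(alpha_i) lies in S(w) and not in S(s_i w), while S(s_i w) gains nothing, since
    s_i changes the sign of no positive root other than alpha_i. *)
Lemma wlength_sgen_lt i w :
  ~~ rpos (wr (winv w) (sroot i)) -> (wlength (wmul (sgen i) w) < wlength w)%N.
Proof.
move=> nr; set r0 := ropp (wr (winv w) (sroot i)).
have ir0 : isroot r0 by rewrite ropp_isroot wr_isroot sroot_isroot.
have wr0 : wr w r0 = ropp (sroot i) by rewrite /r0 wr_opp wrVK.
have nS : r0 \notin Slist (wmul (sgen i) w).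
  by rewrite mem_Slist wrM wr0 wr_opp wr_sroot roppK sroot_pos !andbF.
rewrite !wlength_size; apply: (@uniq_leq_size _ (r0 :: Slist _)) => [|r].
  by rewrite /= nS Slist_uniq.
rewrite inE => /orP[/eqP->|rS].
  by rewrite mem_Slist ir0 wr0 !rpos_opp ?wr_isroot ?sroot_isroot ?sroot_pos ?nr.
have [rE|//] := wlength_sgen_sub rS.
by move: rS; rewrite mem_Slist rE (negPf nr) andbF.
Qed.

Lemma wlength_sgen_gt i w :
  rpos (wr (winv w) (sroot i)) -> (wlength w < wlength (wmul (sgen i) w))%N.
Proof.
move=> pr; rewrite -{1}(wmulsK i w); apply: wlength_sgen_lt.
by rewrite winvM winv_sgen wrM wr_sroot wr_opp rpos_opp ?wr_isroot ?sroot_isroot ?pr.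
Qed.

Lemma wlength_mulr_lt i w :
  ~~ rpos (wr w (sroot i)) -> (wlength (wmul w (sgen i)) < wlength w)%N.
Proof.
move=> nr; rewrite !wlength_size.
rewrite -(size_map (wr (sgen i))) -/(size (sroot i :: map (wr (sgen i)) (Slist (wmul w (sgen i))))).
have key r : r \in Slist (wmul w (sgen i)) -> wr (sgen i) r != sroot i.
  rewrite mem_Slist => /and3P[ir pr _]; apply/eqP => /(congr1 (wr (sgen i))).
  by rewrite -wrM sgenK wr1 wr_sroot => rE; move: pr; rewrite rE rpos_opp ?sroot_isroot ?sroot_pos.
apply: uniq_leq_size => [|r].
  rewrite /= map_inj_uniq ?Slist_uniq ?andbT; last exact: wr_inj.
  by apply/mapP => -[r /key /eqP h1 h2]; apply: h1.
rewrite inE => /orP[/eqP->|]; first by rewrite mem_Slist sroot_isroot sroot_pos.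
move=> /mapP[r' rS ->]; move: rS; rewrite !mem_Slist !wrM wr_isroot => /and3P[ir pr nr'].
rewrite ir nr' andbT rpos_sgen //; apply/eqP => rE.
by move: nr'; rewrite rE wr_sroot wr_opp rpos_opp ?wr_isroot ?sroot_isroot // (negPf nr).
Qed.

Lemma wlength_pi w : wlength (wmul piW w) = wlength w.
Proof.
rewrite !wlength_size; apply/perm_size/uniq_perm; rewrite ?Slist_uniq // => r.
by rewrite !mem_Slist wrM rpos_pi.
Qed.

Lemma wlength_piV w : wlength (wmul (winv piW) w) = wlength w.
Proof. by rewrite -wlength_pi wmulVKw. Qed.

(** This is the homomorphism from W to the integers that kills every s_i and sends pi to 1; it reads
    off the exponent of pi in any word for w. *)
Definition wsum w : int := \sum_j w.2 j.

Lemma wsumM x y : wsum (wmul x y) = wsum x + wsum y.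
Proof.
rewrite /wsum /=; under eq_bigr do rewrite ffunE.
by rewrite big_split /=; congr +%R; rewrite (reindex_inj (@perm_inj _ x.1)) /=; under eq_bigr do rewrite permK.
Qed.

Lemma wsum1 : wsum wone = 0.
Proof. by rewrite /wsum big1 // => j _; rewrite ffunE. Qed.

Lemma wsumV x : wsum (winv x) = - wsum x.
Proof. by apply/eqP; rewrite -addr_eq0 -wsumM wmulVw wsum1. Qed.

Lemma wsum_sgen i : wsum (sgen i) = 0.
Proof. by have := wsumM (sgen i) (sgen i); rewrite sgenK wsum1; lia. Qed.

Lemma wsum_pi : wsum piW = 1.
Proof.
have N0 : (0 < N)%N by lia.
rewrite /wsum (bigD1 (Ordinal N0)) //= ffunE /= big1 ?addr0 // => j.
by rewrite -val_eqE ffunE /= => /negPf->.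
Qed.

Lemma adj_increasing (T : Type) (R : T -> T -> Prop) (f : 'I_N -> T) :
  (forall p q r : T, R p q -> R q r -> R p r) ->
  (forall i, val i != 0%N -> R (f (prevo i)) (f i)) ->
  forall a b, (a < b)%N -> R (f a) (f b).
Proof.
move=> tr adj a [b hb] /=; elim: b hb => // b IH hb ab.
have := adj (Ordinal hb) isT.
have hb' : (b < N)%N by lia.
have -> : prevo (Ordinal hb) = Ordinal hb' by apply: val_inj.
move: ab; rewrite ltnS leq_eqVlt => /orP[/eqP ab|ab].
  by have -> : a = Ordinal hb' by apply: val_inj.
exact/tr/IH.
Qed.

Lemma perm_increasing_id (u : 'S_N) :
  (forall i, val i != 0%N -> (u (prevo i) < u i)%N) -> u = 1%g.
Proof.
move=> h; have inc a b : (a < b)%N -> (u a < u b)%N.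
  by apply: (@adj_increasing _ (fun x y : 'I_N => x < y)%N) => // x y z; apply: ltn_trans.
have ge (n : nat) (hn : (n < N)%N) : (n <= u (Ordinal hn))%N.
  elim: n hn => // n IH hn; have hn' : (n < N)%N by lia.
  exact: leq_ltn_trans (IH hn') (inc (Ordinal hn') (Ordinal hn) (ltnSn n)).
have le (n : nat) (hn : (N - n.+1 < N)%N) : (n < N)%N -> (u (Ordinal hn) <= N - n.+1)%N.
  elim: n hn => [|n IH] hn nN; first by have := ltn_ord (u (Ordinal hn)); lia.
  have hn' : (N - n.+1 < N)%N by lia.
  have := inc (Ordinal hn) (Ordinal hn'); have := IH hn'; rewrite /=; lia.
apply/permP => a; rewrite perm1; apply: val_inj; apply/eqP; rewrite eqn_leq.
case: a => a ha; rewrite ge andbT.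
have ha' : (N - (N - a.+1).+1 < N)%N by lia.
have := le (N - a.+1)%N ha'; have -> : Ordinal ha' = Ordinal ha by apply: val_inj => /=; lia.
by rewrite /=; lia.
Qed.

Variable full : bool.
(** With [full] true the group is W with all its generators; with [full] false it is \bar W, with
    s_1, ..., s_{N-1} only. *)
Definition okS i := full || (val i != 0%N).
Definition okW w := full || (w.2 == [ffun => 0]).

Lemma okW1 : okW wone. Proof. by rewrite /okW eqxx orbT. Qed.

Lemma okWM x y : okW x -> okW y -> okW (wmul x y).
Proof.
rewrite /okW; case: full => //= /eqP hx /eqP hy; apply/eqP/ffunP => j.
by rewrite !ffunE hx hy !ffunE.
Qed.

Lemma okWV x : okW x -> okW (winv x).
Proof. by rewrite /okW; case: full => //= /eqP hx; apply/eqP/ffunP => j; rewrite !ffunE hx !ffunE oppr0. Qed.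

Lemma okW_sgen i : okS i -> okW (sgen i).
Proof. by rewrite /okS /okW /sgen; case: full => //= /negPf ->. Qed.

(** Let v = w^{-1} and let g_j be its translation coordinate at v(j). Positivity of v(alpha_i) for i
    > 0 makes g weakly increasing, with v increasing on ties; positivity of v(alpha_0) bounds the
    last g by the first plus 1 (in \bar W, g is zero anyway). As g sums to zero, it vanishes, and v
    is an increasing permutation. *)
Lemma no_descent_one w : okW w -> wsum w = 0 ->
  (forall i, okS i -> rpos (wr (winv w) (sroot i))) -> w = wone.
Proof.
move=> ow sw nd; pose v := winv w; pose g j := v.2 (v.1 j).
have gs : \sum_j g j = 0.
  by have := wsumV w; rewrite sw oppr0 /wsum (reindex_inj (@perm_inj _ v.1)).
have adj i : val i != 0%N ->
    (g (prevo i) < g i) \/ (g (prevo i) = g i /\ (v.1 (prevo i) < v.1 i)%N).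
  move=> i0; have := nd i; rewrite /okS i0 orbT => /(_ isT).
  rewrite -/v /sroot (negPf i0) /rpos /rootpos /wr /wroot /= -!/(g _).
  by move: (g _) (g i) (nat_of_ord (v.1 _)) (nat_of_ord (v.1 i)) => ????; lia.
have adjle i : val i != 0%N -> g (prevo i) <= g i by move=> /adj; lia.
have inc a b : (a < b)%N -> g a <= g b.
  by apply: (@adj_increasing _ (fun x y : int => x <= y)) => // x y z; apply: le_trans.
have N0 : (0 < N)%N by lia.
pose o := Ordinal N0; pose l := lasto o.
have inc0 a : g o <= g a.
  have [->//|ne] := eqVneq a o; apply: inc; move: ne; rewrite -val_eqE /=; lia.
have incl a : g a <= g l.
  have [->//|ne] := eqVneq a l; apply: inc; have := ltn_ord a; move: ne; rewrite -val_eqE /=; lia.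
have gl : g l <= g o + 1.
  case f: full; last first.
    by have := okWV ow; rewrite /okW f /= => /eqP v0; rewrite /g /v /= v0 !ffunE.
  have := nd o; rewrite /okS f => /(_ isT).
  rewrite -/v /sroot /= /rpos /rootpos /wr /wroot /=.
  have -> : firsto o = o by apply: val_inj.
  by rewrite -/l -/(g l) -/(g o); lia.
have g0 : g o = 0.
  apply/eqP; rewrite eq_le; apply/andP; split.
    rewrite leNgt; apply/negP => h; have : \sum_j g j > 0.
      rewrite (bigD1 o) //=; apply: ltr_pwDl => //; apply: sumr_ge0 => j _.
      by apply: le_trans (inc0 j); apply: ltW.
    by rewrite gs.
  rewrite leNgt; apply/negP => h; have : \sum_j g j < 0.
    rewrite (bigD1 o) //=.
    have : \sum_(i | i != o) g i <= 0.
      by apply: sumr_le0 => j _; apply: le_trans (incl j) _; lia.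
    by move: h; move: (g o) (\sum_(i | _) _) => p q; lia.
  by rewrite gs.
have gz j : g j = 0.
  have /eqP := gs; rewrite psumr_eq0; last by move=> i _; rewrite -g0.
  by move=> /allP/(_ j); rewrite mem_index_enum => /(_ isT)/eqP.
have v1 : v.1 = 1%g.
  apply: perm_increasing_id => i /adj; rewrite !gz; lia.
have : v = wone.
  by apply: W_eqP => // j; have := gz j; rewrite /g v1 perm1 => ->; rewrite ffunE.
by move=> /(congr1 (wmul w)); rewrite wmulwV wmulw1.
Qed.

(** Induction on l(w) + |[wsum w]|: a left descent lowers the first term, and in its absence pi or
    its inverse, which preserves length, lowers the second, until [no_descent_one] applies. It
    replaces the existence of reduced words. *)
Lemma W_ind (P : W N -> Prop) : P wone ->
  (forall i w, okS i -> okW w -> P w -> (wlength w < wlength (wmul (sgen i) w))%N ->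
     P (wmul (sgen i) w)) ->
  (full -> forall w, P w -> P (wmul piW w)) ->
  (full -> forall w, P w -> P (wmul (winv piW) w)) ->
  forall w, okW w -> P w.
Proof.
move=> P1 Ps Pp Pv w; have [n] := ubnP (wlength w + `|wsum w|)%N.
elim: n w => // n IH w hn ow.
case e: [exists i, okS i && ~~ rpos (wr (winv w) (sroot i))].
  have /existsP[i /andP[oi ri]] := e.
  have lt := wlength_sgen_lt ri.
  rewrite -(wmulsK i w); apply: Ps => //; rewrite ?wmulsK //.
    by apply: okWM => //; apply: okW_sgen.
  apply: IH; first by rewrite wsumM wsum_sgen add0r; lia.
  by apply: okWM => //; apply: okW_sgen.
have {e} nd i : okS i -> rpos (wr (winv w) (sroot i)).
  by move: e => /negbT; rewrite negb_exists => /forallP/(_ i); rewrite negb_and negbK => /orP[/negPf->|].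
case f: full.
  have [/eqP s0|sn] := boolP (wsum w == 0); first by rewrite (no_descent_one ow s0 nd).
  have [sp|sm] := ltP 0 (wsum w).
    rewrite -(wmulVKw piW w); apply: Pp => //; apply: IH; last by rewrite /okW f.
    by rewrite wlength_piV wsumM wsumV wsum_pi; move: hn sp; lia.
  rewrite -(wmulKw piW w); apply: Pv => //; apply: IH; last by rewrite /okW f.
  by rewrite wlength_pi wsumM wsum_pi; move: hn sm sn; lia.
suff -> : w = wone by [].
apply: no_descent_one => //; move: ow; rewrite /okW f /= => /eqP w0.
by rewrite /wsum big1 // => j _; rewrite w0 ffunE.
Qed.

End WeylGroup.

(** * Reduced words and inversion sets *)

Section ReducedWords.
Variable N : nat.
Hypothesis N2 : (2 <= N)%N.
Implicit Types (w x : W N) (js : seq 'I_N).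

Definition wword js : W N := foldr wmul wone (map sgen js).

Fixpoint word_roots js : seq (aroot N) :=
  if js is i :: js' then wr (winv (wword js')) (sroot i) :: word_roots js' else [::].

Lemma Slist_word_sub js : {subset Slist (wword js) <= word_roots js}.
Proof.
elim: js => [|i js IH] r /=.
  by rewrite mem_Slist [wword _]/(wone) wr1 => /and3P[_ ->].
by rewrite inE => /(wlength_sgen_sub N2)[->|/IH->]; rewrite ?eqxx ?orbT.
Qed.

Lemma Slist_pow k w : Slist (wmul (wpowz piW k) w) =i Slist w.
Proof. by move=> r; rewrite !mem_Slist wrM rpos_pow. Qed.

(** S(x) is duplicate-free, contained in [word_roots], and of the same size, so the two have the
    same elements. The length condition of [is_red] thereby turns into information on every root met
    along the word, which is what decides whether each intertwiner is invertible. *)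
Lemma is_red_roots x rd : is_red x rd -> {subset word_roots rd.2 <= Slist x}.
Proof.
move=> [xE sz] r.
have sub : {subset Slist x <= word_roots rd.2}.
  by move=> r'; rewrite xE Slist_pow => /Slist_word_sub.
have szr : size (word_roots rd.2) = size rd.2 by elim: rd.2 => //= i js ->.
have [_ mE] := uniq_min_size (Slist_uniq x) sub (eq_leq (etrans szr (etrans sz (wlength_size x)))).
by rewrite mE.
Qed.

End ReducedWords.

(** * Weight vectors and intertwiners *)

Section Subspaces.
Variables (F : numClosedFieldType) (V U : lmodType F) (f : V -> U).
Hypothesis lf : lin f.

Lemma linD u v : f (u + v) = f u + f v.
Proof. by have := lf 1 u v; rewrite !scale1r. Qed.

Lemma lin0 : f 0 = 0.
Proof. by apply: (addrI (f 0)); rewrite -linD !addr0. Qed.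

Lemma linZ a u : f (a *: u) = a *: f u.
Proof. by have := lf a u 0; rewrite lin0 !addr0. Qed.

Lemma linB u v : f (u - v) = f u - f v.
Proof. by rewrite linD -scaleN1r linZ scaleN1r. Qed.

Lemma lin_sum (I : Type) (s : seq I) (P : pred I) (g : I -> V) :
  f (\sum_(i <- s | P i) g i) = \sum_(i <- s | P i) f (g i).
Proof. exact: (big_morph f linD lin0). Qed.

Definition subsp (Q : V -> Prop) :=
  [/\ Q 0, forall u v, Q u -> Q v -> Q (u + v) & forall a u, Q u -> Q (a *: u)].

(** The span is the intersection of all subspaces containing S, so a membership hypothesis is itself
    the induction principle: it is applied directly to the subspace to be proved. *)
Definition lspan (S : V -> Prop) (v : V) :=
  forall Q, subsp Q -> (forall u, S u -> Q u) -> Q v.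

Lemma span_subsp S : subsp (lspan S).
Proof.
split=> [Q [] //|u v hu hv Q sQ SQ|a u hu Q sQ SQ]; have [_ QD QZ] := sQ.
  by apply: QD; [apply: hu|apply: hv].
by apply: QZ; apply: hu.
Qed.

Lemma span_gen (S : V -> Prop) v : S v -> lspan S v.
Proof. by move=> Sv Q _; apply. Qed.

Lemma subspB Q u v : subsp Q -> Q u -> Q v -> Q (u - v).
Proof. by move=> [_ QD QZ] Qu Qv; rewrite -scaleN1r; apply/QD/QZ. Qed.

Lemma subsp_sum Q (I : eqType) (s : seq I) (g : I -> V) :
  subsp Q -> (forall i, i \in s -> Q (g i)) -> Q (\sum_(i <- s) g i).
Proof.
move=> [Q0 QD _]; elim: s => [|i s IH] h; first by rewrite big_nil.
rewrite big_cons; apply: QD; first by apply: h; rewrite inE eqxx.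
by apply: IH => j js; apply: h; rewrite inE js orbT.
Qed.

Lemma subspZ Q a u : subsp Q -> a != 0 -> Q (a *: u) -> Q u.
Proof. by move=> [_ _ QZ] a0 /(QZ a^-1); rewrite scalerA mulVf // scale1r. Qed.

End Subspaces.

Lemma preim_subsp (F : numClosedFieldType) (V U : lmodType F) (f : V -> U) (Q : U -> Prop) :
  lin f -> subsp Q -> subsp (fun v => Q (f v)).
Proof.
move=> lf [Q0 QD QZ]; split=> [|u v|a u]; first by rewrite lin0.
  by rewrite linD //; apply: QD.
by rewrite linZ //; apply: QZ.
Qed.

Lemma line_subsp (F : numClosedFieldType) (V : lmodType F) (v : V) : subsp (fun u => exists c, u = c *: v).
Proof.
split=> [|u w [c ->] [d ->]|a u [c ->]]; first by exists 0; rewrite scale0r.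
  by exists (c + d); rewrite scalerDl.
by exists (a * c); rewrite scalerA.
Qed.

Section Weights.
Variables (F : numClosedFieldType) (N : nat).
Implicit Types (z : tdual F N) (xi : tvec F N) (w x y : W N) (r : aroot N).

Definition ev z xi : F := \sum_j xi.1 j * z.1 j + xi.2 * z.2.
Definition pz z r : F := pair_root z r.1.1 r.1.2 r.2.

Lemma tdual_eqP z z' : z.2 = z'.2 -> (forall j, z.1 j = z'.1 j) -> z = z'.
Proof. by case: z z' => [z c] [z' c'] /= -> h; congr pair; apply/ffunP. Qed.

Lemma wact_dualM x y z : wact_dual (wmul x y) z = wact_dual x (wact_dual y z).
Proof.
apply: tdual_eqP => // j; rewrite !ffunE /= invMg permM rmorphD /=; ring.
Qed.

Lemma wact_dual1 z : wact_dual wone z = z.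
Proof. by apply: tdual_eqP => // j; rewrite !ffunE /= invg1 perm1 mulr0 addr0. Qed.

Lemma wact_dualK w z : wact_dual (winv w) (wact_dual w z) = z.
Proof. by rewrite -wact_dualM wmulVw wact_dual1. Qed.

Lemma wact_tM x y xi : wact_t (wmul x y) xi = wact_t x (wact_t y xi).
Proof.
apply: tdual_eqP => [|j] /=; last by rewrite !ffunE /= invMg permM.
rewrite -!addrA -!opprD; congr (_ - _).
rewrite [X in _ = X + _](reindex_inj (@perm_inj _ (x.1^-1)%g)) /= -big_split /=.
by apply: eq_bigr => j _; rewrite !ffunE /= invMg permM rmorphD /=; ring.
Qed.

Lemma wact_t1 xi : wact_t wone xi = xi.
Proof.
apply: tdual_eqP => [|j] /=; last by rewrite !ffunE /= invg1 perm1.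
by rewrite big1 ?subr0 // => j _; rewrite !ffunE mul0r.
Qed.

Lemma wact_tK w xi : wact_t (winv w) (wact_t w xi) = xi.
Proof. by rewrite -wact_tM wmulVw wact_t1. Qed.

Lemma wact_tVK w xi : wact_t w (wact_t (winv w) xi) = xi.
Proof. by rewrite -wact_tM wmulwV wact_t1. Qed.

Lemma ev_wact w z xi : ev (wact_dual w z) (wact_t w xi) = ev z xi.
Proof.
rewrite /ev /= mulrBl addrCA -[RHS]addrC; congr +%R.
rewrite [RHS](reindex_inj (@perm_inj _ (w.1^-1)%g)) /= mulr_suml -sumrB.
by apply: eq_bigr => j _; rewrite !ffunE; ring.
Qed.

Lemma pz_wact w z r : pz (wact_dual w z) (wr w r) = pz z r.
Proof.
by case: r => [[a b] k]; rewrite /pz /pair_root /wr /wroot /= !ffunE !permK !rmorphB /=; ring.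
Qed.

Lemma pz_wactV w z r : pz (wact_dual w z) r = pz z (wr (winv w) r).
Proof. by rewrite -{1}(wrVK w r) pz_wact. Qed.

Lemma pz_opp z r : pz z (ropp r) = - pz z r.
Proof. by case: r => [[a b] k]; rewrite /pz /pair_root /= rmorphN /=; ring. Qed.

Lemma coroot1 i j : (@coroot F N i).1 j = (j == (sroot i).1.1)%:R - (j == (sroot i).1.2)%:R.
Proof. by rewrite /coroot /sroot; case: ifP => _; rewrite ffunE. Qed.

Lemma sum_delta (a : 'I_N) (g : 'I_N -> F) : \sum_j (j == a)%:R * g j = g a.
Proof.
rewrite (bigD1 a) //= eqxx mul1r big1 ?addr0 // => j /negPf->; exact: mul0r.
Qed.

Lemma ev_coroot z i : ev z (coroot i) = pz z (sroot i).
Proof.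
rewrite /ev; under eq_bigr do rewrite coroot1 mulrBl.
rewrite sumrB !sum_delta /pz /pair_root; congr (_ + _ * _).
by rewrite /coroot /sroot; case: ifP.
Qed.

Lemma alpha_of_sum i xi : alpha_of i xi = \sum_j (@coroot F N i).1 j * xi.1 j.
Proof.
under eq_bigr do rewrite coroot1 mulrBl.
by rewrite sumrB !sum_delta /alpha_of /sroot; case: ifP.
Qed.

Hypothesis N2 : (2 <= N)%N.

Lemma wact_dual_sgen z i j :
  (wact_dual (sgen i) z).1 j = z.1 j - pz z (sroot i) * (coroot i).1 j.
Proof.
rewrite coroot1 ffunE /pz /pair_root /sgen /sroot; case: ifP => i0 /=; rewrite tpermV ffunE.
  have fl : firsto i != lasto i by rewrite -val_eqE /=; move: N2; lia.
  have [->|jf] := eqVneq j (firsto i).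
    by rewrite tpermL (negPf fl) /= (_ : (0%N == N.-1) = false) /=; [ring|move: N2; lia].
  have [->|jl] := eqVneq j (lasto i).
    by rewrite tpermR /= eqxx (_ : (N.-1 == 0%N) = false) /=; [ring|move: N2; lia].
  have -> : tperm (firsto i) (lasto i) j = j by rewrite tpermD // eq_sym.
  have -> : (val j == 0%N) = false by apply/negbTE; move: jf; rewrite -val_eqE.
  have -> : (val j == N.-1) = false by apply/negbTE; move: jl; rewrite -val_eqE.
  by rewrite /=; ring.
have pi : prevo i != i by rewrite -val_eqE /=; move: i0 => /=; lia.
have [->|jf] := eqVneq j (prevo i); first by rewrite tpermL (negPf pi) /=; ring.
have [->|jl] := eqVneq j i; first by rewrite tpermR /=; ring.
have -> : tperm (prevo i) i j = j by rewrite tpermD // eq_sym.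
by rewrite /=; ring.
Qed.

Lemma ev_sgen z i xi : ev z (wact_t (sgen i) xi) = ev z xi - alpha_of i xi * pz z (sroot i).
Proof.
have {1}-> : z = wact_dual (sgen i) (wact_dual (sgen i) z).
  by rewrite -wact_dualM sgenK // wact_dual1.
rewrite ev_wact /ev; under eq_bigr do rewrite wact_dual_sgen mulrBr.
rewrite sumrB /= addrAC alpha_of_sum mulr_suml; congr (_ - _).
by apply: eq_bigr => j _; ring.
Qed.

Lemma alpha_of_sgen i xi : alpha_of i (wact_t (sgen i) xi) = - alpha_of i xi.
Proof.
by rewrite /alpha_of /wact_t /sgen; case: ifP => /= h; rewrite !ffunE /= h !tpermV tpermL tpermR; ring.
Qed.

End Weights.

(** * Modules over H or over \bar H, and their intertwiners *)

Section PartialModules.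
Variables (F : numClosedFieldType) (N : nat).
Hypothesis N2 : (2 <= N)%N.
Variable full : bool.

(* [full = true] gives the defining relations of H; [full = false] keeps only those of the
   finite part, so that a module over \bar H on which c acts by a scalar also qualifies. *)
Definition is_pmod (V : lmodType F) (M : Hops F N V) : Prop :=
  [/\ (forall x, lin (hW M x)) /\ (forall i, lin (hX M i)) /\ lin (hC M),
      (forall v, hW M wone v = v) /\ (forall x y v, hW M (wmul x y) v = hW M x (hW M y v)),
      (forall i j v, hX M i (hX M j v) = hX M j (hX M i v)) /\
      (forall i v, hX M i (hC M v) = hC M (hX M i v)),
      (forall i xi v, okS full i ->
         hW M (sgen i) (actT M xi v) - actT M (wact_t (sgen i) xi) (hW M (sgen i) v)
           = - alpha_of i xi *: v)
    & (full -> forall xi v, hW M piW (actT M xi v) = actT M (wact_t piW xi) (hW M piW v))].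

Variables (V : lmodType F) (M : Hops F N V).
Hypothesis hM : is_pmod M.
Implicit Types (z : tdual F N) (xi : tvec F N) (w x y : W N) (v : V) (L : seq ('I_N * F)).

Lemma lW x : lin (hW M x). Proof. by case: hM => -[]. Qed.
Lemma lX i : lin (hX M i). Proof. by case: hM => -[_ []]. Qed.
Lemma lC : lin (hC M). Proof. by case: hM => -[_ []]. Qed.
Lemma hW1 v : hW M wone v = v. Proof. by case: hM => _ []. Qed.
Lemma hWM x y v : hW M (wmul x y) v = hW M x (hW M y v). Proof. by case: hM => _ []. Qed.
Lemma hXC i j v : hX M i (hX M j v) = hX M j (hX M i v). Proof. by case: hM => _ _ []. Qed.

Lemma hWK x v : hW M x (hW M (winv x) v) = v. Proof. by rewrite -hWM wmulwV hW1. Qed.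
Lemma hWVK x v : hW M (winv x) (hW M x v) = v. Proof. by rewrite -hWM wmulVw hW1. Qed.
Lemma hsK i v : hW M (sgen i) (hW M (sgen i) v) = v.
Proof. by rewrite -hWM sgenK // hW1. Qed.

Lemma lin_actT xi : lin (actT M xi).
Proof.
move=> a u v; rewrite /actT (lC a u v) [xi.2 *: _]scalerDr [a *: (_ + _)]scalerDr addrACA.
congr +%R; last by rewrite !scalerA mulrC.
rewrite scaler_sumr -big_split /=.
by apply: eq_bigr => j _; rewrite lX scalerDr !scalerA mulrC.
Qed.

Lemma hs_actT i xi v : okS full i -> hW M (sgen i) (actT M xi v) =
  actT M (wact_t (sgen i) xi) (hW M (sgen i) v) - alpha_of i xi *: v.
Proof.
case: hM => _ _ _ h _ oi; have /eqP := h i xi v oi.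
by rewrite subr_eq => /eqP ->; rewrite scaleNr addrC.
Qed.

Lemma actT_hs i xi v : okS full i -> actT M xi (hW M (sgen i) v) =
  hW M (sgen i) (actT M (wact_t (sgen i) xi) v) - alpha_of i xi *: v.
Proof.
move=> oi; rewrite hs_actT // alpha_of_sgen scaleNr opprK addrK.
by rewrite -wact_tM sgenK // wact_t1.
Qed.

Lemma hpi_actT xi v : full -> hW M piW (actT M xi v) = actT M (wact_t piW xi) (hW M piW v).
Proof. by case: hM => _ _ _ _ h ff; apply: h. Qed.

Lemma actT_hpi xi v : full -> actT M xi (hW M piW v) = hW M piW (actT M (wact_t (winv piW) xi) v).
Proof. by move=> ff; rewrite hpi_actT // wact_tVK. Qed.

Lemma actT_hpiV xi v : full ->
  actT M xi (hW M (winv piW) v) = hW M (winv piW) (actT M (wact_t piW xi) v).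
Proof. by move=> ff; rewrite -[LHS](hWVK piW) hpi_actT // hWK. Qed.

Definition wt z v := (forall i, hX M i v = z.1 i *: v) /\ hC M v = z.2 *: v.

Lemma actT_wt z xi v : wt z v -> actT M xi v = ev z xi *: v.
Proof.
move=> [hx hc]; rewrite /actT /ev scalerDl scaler_suml hc scalerA; congr +%R.
by apply: eq_bigr => j _; rewrite hx scalerA.
Qed.

Definition tbasis i : tvec F N := ([ffun j => (j == i)%:R], 0).

Lemma actT_tbasis i v : actT M (tbasis i) v = hX M i v.
Proof.
rewrite /actT scale0r addr0 (bigD1 i) //= ffunE eqxx scale1r big1 ?addr0 // => j /negPf ji.
by rewrite ffunE ji scale0r.
Qed.

Lemma ev_tbasis z i : ev z (tbasis i) = z.1 i.
Proof. by rewrite /ev mul0r addr0 /=; under eq_bigr do rewrite ffunE; rewrite sum_delta. Qed.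

Lemma wtP z v : (forall xi, actT M xi v = ev z xi *: v) -> wt z v.
Proof.
move=> h; split=> [i|]; first by rewrite -actT_tbasis h ev_tbasis.
have := h ([ffun => 0], 1); rewrite /actT /ev /=.
under eq_bigr do rewrite ffunE scale0r; under [in RHS]eq_bigr do rewrite ffunE mul0r.
by rewrite !big1 // !add0r scale1r mul1r.
Qed.

Lemma wtZ z a v : wt z v -> wt z (a *: v).
Proof.
by move=> [hx hc]; split=> [i|]; rewrite linZ ?hx ?hc ?scalerA 1?mulrC //; [exact: lX|exact: lC].
Qed.

Lemma phi_wt z i v : wt z v -> phi_gen M i v = v + pz z (sroot i) *: hW M (sgen i) v.
Proof. by move=> hv; rewrite /phi_gen (actT_wt _ hv) ev_coroot linZ //; exact: lW. Qed.

Lemma wt_phi z i v : okS full i -> wt z v -> wt (wact_dual (sgen i) z) (phi_gen M i v).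
Proof.
move=> oi hv; rewrite (phi_wt i hv); apply: wtP => xi.
rewrite (linD (lin_actT xi)) (linZ (lin_actT xi)) (actT_wt _ hv) actT_hs // (actT_wt _ hv).
have -> : ev (wact_dual (sgen i) z) xi = ev z (wact_t (sgen i) xi).
  rewrite -[xi in LHS](wact_t1 xi) -(sgenK N2 i) wact_tM ev_wact //.
rewrite (linZ (lW _)) scalerBr addrCA [RHS]scalerDr [RHS]addrC; congr +%R.
  by rewrite !scalerA mulrC.
by rewrite scalerA -scalerBl ev_sgen // mulrC.
Qed.

Lemma phi_phi z i v : okS full i -> wt z v ->
  phi_gen M i (phi_gen M i v) = (1 - pz z (sroot i) ^+ 2) *: v.
Proof.
move=> oi hv; rewrite (phi_wt i (wt_phi oi hv)) (phi_wt i hv).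
have -> : pz (wact_dual (sgen i) z) (sroot i) = - pz z (sroot i).
  by rewrite pz_wactV winv_sgen // wr_sroot // pz_opp.
rewrite (linD (lW _)) (linZ (lW _)) hsK scaleNr scalerDr opprD scalerA addrA addrK.
by rewrite scalerBl scale1r -expr2.
Qed.

Lemma wt_pi z v : full -> wt z v -> wt (wact_dual piW z) (hW M piW v).
Proof.
move=> ff hv; apply: wtP => xi; rewrite actT_hpi // (actT_wt _ hv) (linZ (lW _)).
by rewrite -[in RHS](wact_tVK piW xi) ev_wact.
Qed.

Lemma wt_piV z v : full -> wt z v -> wt (wact_dual (winv piW) z) (hW M (winv piW) v).
Proof.
move=> ff hv; apply: wtP => xi; rewrite actT_hpiV // (actT_wt _ hv) (linZ (lW _)).
by rewrite -[xi in RHS](wact_tK piW xi) ev_wact.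
Qed.

Definition kill L v : V := foldr (fun p u => hX M p.1 u - p.2 *: u) v L.

Lemma lin_kill L : lin (kill L).
Proof.
elim: L => [|p L IH] a u v //=; rewrite IH lX scalerDr scalerBr !scalerA [p.2 * a]mulrC.
by rewrite opprD addrACA.
Qed.

Lemma kill_cat L1 L2 v : kill (L1 ++ L2) v = kill L1 (kill L2 v).
Proof. by rewrite /kill foldr_cat. Qed.

Lemma kill_X L i v : kill L (hX M i v) = hX M i (kill L v).
Proof. by elim: L => //= p L ->; rewrite hXC (linB (lX _)) (linZ (lX _)). Qed.

Lemma killC L1 L2 v : kill L1 (kill L2 v) = kill L2 (kill L1 v).
Proof.
elim: L1 => //= p L IH; rewrite IH (linB (lin_kill _)) (linZ (lin_kill _)).
by rewrite kill_X.
Qed.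

Lemma kill_wt z L v : wt z v -> kill L v = (\prod_(p <- L) (z.1 p.1 - p.2)) *: v.
Proof.
move=> hv; elim: L => [|p L IH]; first by rewrite big_nil scale1r.
rewrite /= IH big_cons (linZ (lX _)) hv.1 !scalerA -scalerBl; congr (_ *: _); ring.
Qed.

Definition good (zb : {ffun 'I_N -> F}) L := all (fun p => zb p.1 != p.2) L.
(* On a vector of weight zb the product [kill L] is an invertible scalar, so this brings v itself
   into D. *)
Definition carried (zb : {ffun 'I_N -> F}) (D : V -> Prop) v := exists2 L, good zb L & D (kill L v).

Section Carried.
Variables (zb : {ffun 'I_N -> F}) (D : V -> Prop).
Hypotheses (sD : subsp D) (DX : forall i v, D v -> D (hX M i v)).

Lemma kill_stable L v : D v -> D (kill L v).
Proof.
move=> Dv; elim: L => //= p L IH; apply: subspB => //; first exact: DX.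
by case: sD => _ _; apply.
Qed.

(** Two vectors are carried into D by different lists; the concatenated list works for both, because
    the factors commute and D is stable under each of them. *)
Lemma carried_subsp : subsp (carried zb D).
Proof.
have [D0 DD DZ] := sD; split=> [|u v [L gL hL] [L' gL' hL']|a u [L gL hL]].
- by exists [::].
- exists (L ++ L'); first by rewrite /good all_cat; apply/andP.
  rewrite kill_cat !(linD (lin_kill _)); apply: DD; last exact: kill_stable.
  by rewrite killC; apply: kill_stable.
- by exists L => //; rewrite (linZ (lin_kill _)); apply: DZ.
Qed.

Lemma carried_step i c v : zb i != c -> carried zb D (hX M i v - c *: v) -> carried zb D v.
Proof.
move=> zc [L gL hL]; exists (L ++ [:: (i, c)]); last by rewrite kill_cat.
by rewrite /good all_cat /= zc !andbT.
Qed.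

Lemma carried_base v : D v -> carried zb D v.
Proof. by exists [::]. Qed.

Lemma carried_wt z v : z.1 = zb -> wt z v -> carried zb D v -> D v.
Proof.
move=> zE hv [L gL]; rewrite (kill_wt _ hv); apply: subspZ => //.
elim: L gL => [|p L IH] /=; first by rewrite big_nil oner_eq0.
by move=> /andP[h /IH h']; rewrite big_cons mulf_neq0 // subr_eq0 zE.
Qed.

End Carried.
End PartialModules.

(** * Cyclic modules of generic weight *)

Section Blocks.
Variables (N : nat) (sel : 'I_N -> bool).
Implicit Types (a b c j : 'I_N).
Local Notation sb := (sameblk sel).

Lemma sameblkP a b : reflect (forall j, (minn a b < j <= maxn a b)%N -> sel j) (sb a b).
Proof.
by apply: (iffP forallP) => h j; [move=> hj; have /implyP := h j; apply|apply/implyP => hj; apply: h].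
Qed.

Lemma sameblk_refl a : sb a a.
Proof. by apply/sameblkP => j; lia. Qed.

Lemma sameblk_sym a b : sb a b = sb b a.
Proof. by rewrite /sameblk minnC maxnC. Qed.

Lemma sameblk_trans b a c : sb a b -> sb b c -> sb a c.
Proof.
move=> /sameblkP h1 /sameblkP h2; apply/sameblkP => j hj.
have [h|h] := boolP (minn a b < j <= maxn a b)%N; first exact: h1.
by apply: h2; move: hj h; lia.
Qed.

Lemma sameblk_ind (R : 'I_N -> 'I_N -> Prop) :
  (forall i, val i != 0%N -> sel i -> R (prevo i) i) ->
  (forall a b c, (a < b)%N -> (b < c)%N -> R a b -> R b c -> R a c) ->
  forall a b, (a < b)%N -> sb a b -> R a b.
Proof.
move=> Rs Rt a [b hb] /=; elim: b hb => // b IH hb ab sab.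
have hb' : (b < N)%N by lia.
have sob : sel (Ordinal hb) by move/sameblkP: sab; apply; rewrite /=; lia.
have := Rs (Ordinal hb) isT sob.
have -> : prevo (Ordinal hb) = Ordinal hb' by apply: val_inj.
move: (ab); rewrite ltnS leq_eqVlt => /orP[/eqP ab'|ab'].
  by have -> : a = Ordinal hb' by apply: val_inj.
apply: Rt => //=; apply: IH => //; apply/sameblkP => i hi.
by move/sameblkP: sab; apply; move: hi; rewrite /=; lia.
Qed.

End Blocks.

(** * Minimal representatives of the cosets of \bar W_beta *)

Section MinimalRepresentatives.
Variables (N : nat) (sel : 'I_N -> bool).
Implicit Types (w : W N) (i a b c : 'I_N) (r : aroot N).

Definition inR r : bool := inRgp sel r.1.1 r.1.2 r.2.

Lemma rpos_add a b c (k l : int) : a != b ->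
  rpos (a, c, k) -> rpos (c, b, l) -> rpos (a, b, k + l).
Proof.
rewrite -val_eqE /rpos /rootpos /=.
by move: (nat_of_ord a) (nat_of_ord b) (nat_of_ord c) => p q m; lia.
Qed.

(** Minimality of w in its coset, tested by signs on the simple block roots instead of by lengths.
    The link with lengths is [wlength_mulr_lt] in one direction and [minrep_wlength] in the
    other. *)
Definition minrep w := [forall p : 'I_N, (val p != 0%N) && sel p ==> rpos (wr w (sroot p))].

(** A positive block root is a sum of simple ones, and a root that is the sum of two positive roots
    is positive. *)
Lemma minrepP w r : minrep w -> inR r -> rpos (wr w r).
Proof.
move=> mw; case: r => [[a b] k]; rewrite /inR /inRgp /= => /and3P[/eqP-> ab].
apply: (sameblk_ind (R := fun a b => rpos (wr w (a, b, 0)))) ab => [i i0 si|{a b k}a b c ab bc h h'].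
  by have /forallP/(_ i) := mw; rewrite i0 si /sroot (negPf i0).
have ac : w.1 a != w.1 c.
  by rewrite (inj_eq perm_inj) -val_eqE /= neq_ltn (ltn_trans ab bc).
have := rpos_add ac h h'; rewrite /wr /wroot /=.
by congr (rpos (_, _, _)); ring.
Qed.

Lemma minrep1 (N2 : (2 <= N)%N) : minrep wone.
Proof. by apply/forallP => p; apply/implyP => _; rewrite wr1 sroot_pos. Qed.

Lemma minrepPn w : ~~ minrep w -> exists p, [/\ val p != 0%N, sel p & ~~ rpos (wr w (sroot p))].
Proof.
by rewrite negb_forall => /existsP[p]; rewrite negb_imply => /andP[/andP[? ?] ?]; exists p.
Qed.

Lemma sroot_inR i : val i != 0%N -> sel i -> inR (sroot i).
Proof.
move=> i0 si; rewrite /sroot (negPf i0) /inR /inRgp /=; apply/andP; split.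
  by move: i0 => /=; lia.
apply/forallP => j; apply/implyP => /= hj.
by have -> : j = i by apply: val_inj; move: hj i0 => /=; lia.
Qed.

Lemma in_Wbar_sgen i : val i != 0%N -> sel i -> in_Wbar_gamma sel (sgen i).
Proof. by move=> i0 si; exists [:: i]; rewrite /= i0 si wmulw1. Qed.

(** Deodhar's lemma: alpha_i is the only positive root that s_i makes negative, so minimality can
    only be lost through a simple block root that w sends to alpha_i. In that case (w(zeta),
    alpha_i) = -1. *)
Lemma minrep_sgen i w : (2 <= N)%N -> minrep w -> ~~ minrep (wmul (sgen i) w) ->
  exists p, [/\ val p != 0%N, sel p & wr w (sroot p) = sroot i].
Proof.
move=> N2 mw /minrepPn[p [p0 sp]]; rewrite wrM => np; exists p; split=> //.
apply/eqP; apply: contraNT np => ne; apply: rpos_sgen => //.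
  by rewrite wr_isroot sroot_isroot.
exact: minrepP mw (sroot_inR p0 sp).
Qed.

End MinimalRepresentatives.

(** * Pairings and stabilizers of generic weights *)

Section GenericWeights.
Variables (F : numClosedFieldType) (N : nat) (full : bool) (sel : 'I_N -> bool) (z0 : tdual F N).
Implicit Types (w : W N) (i a b : 'I_N) (r : aroot N).

Definition okR r := full || (r.2 == 0).

Definition pgeneric := forall r, okR r -> isroot r -> rpos r -> ~~ inR sel r ->
  [/\ pz z0 r != 1, pz z0 r != 0 & pz z0 r != -1].

Lemma okR_wr w r : okW full w -> okR r -> okR (wr w r).
Proof.
rewrite /okW /okR; case: full => //= /eqP w0 /eqP r0.
by rewrite /wr /wroot /= w0 r0 !ffunE.
Qed.

Lemma okR_opp r : okR (ropp r) = okR r.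
Proof. by rewrite /okR /= oppr_eq0. Qed.

Lemma okR_sroot i : okS full i -> okR (sroot i).
Proof. by rewrite /okR /okS /sroot; case: full => //= /negPf ->. Qed.

Hypothesis htd : in_tdual_gamma sel z0.

(** Along a block zeta is an arithmetic progression of step 1, so the pairing is minus the height of
    the root. *)
Lemma pz_block r : inR sel r -> pz z0 r = - (val r.1.2 - val r.1.1)%:R.
Proof.
case: r => [[a b] k]; rewrite /inR /inRgp /pz /pair_root /= => /and3P[/eqP-> ab].
rewrite mul0r addr0.
apply: (sameblk_ind (R := fun a b => z0.1 a - z0.1 b = - (b - a)%:R)) ab => [i i0 si|{a b k}a b c ab bc h h'].
  by rewrite htd //=; have -> : (i - i.-1 = 1)%N by move: i0 => /=; lia.
have -> : z0.1 a - z0.1 c = (z0.1 a - z0.1 b) + (z0.1 b - z0.1 c) by ring.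
by rewrite h h' -opprD -natrD; congr (- _%:R); lia.
Qed.

Hypothesis hgen : pgeneric.

Lemma pz_neq0 r : okR r -> isroot r -> pz z0 r != 0.
Proof.
suff h r' : okR r' -> isroot r' -> rpos r' -> pz z0 r' != 0.
  move=> okr ir; have [/h->//|nr] := boolP (rpos r).
  by rewrite -(roppK r) pz_opp oppr_eq0 h ?okR_opp ?ropp_isroot ?rpos_opp.
move=> okr ir pr; have [rR|nR] := boolP (inR sel r'); last by have [] := hgen okr ir pr nR.
rewrite pz_block // oppr_eq0 pnatr_eq0; move: rR; rewrite /inR /inRgp => /and3P[_ h _].
by move: h => /=; lia.
Qed.

Lemma pz_resonant r : okR r -> isroot r -> (pz z0 r == 1) || (pz z0 r == -1) ->
  inR sel r \/ inR sel (ropp r).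
Proof.
suff h r' : okR r' -> isroot r' -> rpos r' -> (pz z0 r' == 1) || (pz z0 r' == -1) -> inR sel r'.
  move=> okr ir pm; have [pr|nr] := boolP (rpos r); first by left; apply: h.
  right; apply: h; rewrite ?okR_opp ?ropp_isroot ?rpos_opp //.
  by rewrite pz_opp eqr_oppLR eqr_opp orbC.
move=> okr ir pr pm; apply/idPn => /(hgen okr ir pr)[/negPf h1 _ /negPf h2].
by rewrite h1 h2 in pm.
Qed.

Hypothesis hc : full -> z0.2 != 0.

(** If w fixes zeta on \bar t and moves an index j, then zeta vanishes on a root joining j to its
    image, which [pz_neq0] forbids. So w is a translation by some eta, which shifts zeta by zeta(c)
    eta, and eta = 0 because zeta(c) is nonzero. *)
Lemma wact_stab w : okW full w -> (wact_dual w z0).1 = z0.1 -> w = wone.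
Proof.
move=> ow e; have w1 : w.1 = 1%g.
  apply/permP => j; rewrite perm1; apply/eqP/idPn => ne.
  have /eqP : pz z0 (j, w.1 j, w.2 (w.1 j)) = 0.
    have := congr1 (fun g : {ffun _} => g (w.1 j)) e; rewrite ffunE permK /pz /pair_root /=.
    by move=> <-; rewrite [in X in _ - X]mulrC; ring.
  apply/negP/pz_neq0; last by rewrite /isroot /= eq_sym.
  by move: ow; rewrite /okR /okW => /orP[->//|/eqP ->]; rewrite ffunE eqxx orbT.
apply: W_eqP => // j; rewrite ffunE.
move: ow; rewrite /okW => /orP[ff|/eqP->]; last by rewrite ffunE.
have := congr1 (fun g : {ffun _} => g j) e; rewrite ffunE w1 invg1 perm1 => /eqP.
by rewrite -subr_eq0 addrAC subrr add0r mulf_eq0 (negPf (hc ff)) /= intr_eq0 => /eqP.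
Qed.

Lemma wact_inj w w' : okW full w -> okW full w' ->
  (wact_dual w z0).1 = (wact_dual w' z0).1 -> w = w'.
Proof.
move=> ow ow' e; have {}e : wact_dual w z0 = wact_dual w' z0.
  by apply: tdual_eqP => // j; rewrite e.
have : wmul (winv w') w = wone.
  apply: wact_stab; first by apply: okWM => //; apply: okWV.
  by rewrite wact_dualM e wact_dualK.
by move=> /(congr1 (wmul w')); rewrite wmulVKw wmulw1.
Qed.

End GenericWeights.

(** * Weights, reachable vectors and submodules of a cyclic module *)

Section CyclicModules.
Variables (F : numClosedFieldType) (N : nat) (full : bool) (sel : 'I_N -> bool) (z0 : tdual F N).
Hypotheses (N2 : (2 <= N)%N) (htd : in_tdual_gamma sel z0) (hgen : pgeneric full sel z0)
  (hc : full -> z0.2 != 0).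
Variables (V : lmodType F) (M : Hops F N V) (one : V).
Hypotheses (hM : is_pmod full M) (hrel : relH sel z0 M one).
Implicit Types (w : W N) (i : 'I_N) (v : V) (Q : V -> Prop).

Local Notation wz w := (wact_dual w z0).

Lemma wt_one : wt M z0 one.
Proof. by case: hrel => _ h1 h2; split. Qed.

Definition below (n : nat) v :=
  lspan (fun u => exists2 w, okW full w && (wlength w < n)%N & u = hW M w one) v.

Lemma below_sub n : subsp (below n). Proof. exact: span_subsp. Qed.

(** Moving xi to the right past s_i replaces it by s_i(xi) and leaves a multiple of the shorter
    vector; moving it past pi leaves no remainder. *)
Lemma triangular w : okW full w -> forall xi,
  below (wlength w) (actT M xi (hW M w one) - ev (wz w) xi *: hW M w one).
Proof.
move: w; apply: (W_ind N2).
- move=> xi; rewrite (hW1 hM) wact_dual1 (actT_wt xi wt_one) subrr.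
  by case: (below_sub (wlength (@wone N))).
- move=> i w oi ow IH lt xi; rewrite !(hWM hM) (actT_hs N2 hM) // wact_dualM.
  have -> : ev (wact_dual (sgen i) (wz w)) xi = ev (wz w) (wact_t (sgen i) xi).
    by rewrite -[xi in LHS](wact_t1 xi) -(sgenK N2 i) wact_tM ev_wact.
  set c := ev _ _; set v := hW M w one.
  rewrite addrAC -(linZ (lW hM _)) -(linB (lW hM _)).
  have sB := below_sub (wlength (wmul (sgen i) w)); have [_ _ SZ] := sB.
  apply: (subspB sB); last first.
    by apply: SZ; apply: span_gen; exists w; rewrite // ow.
  apply: (IH (wact_t (sgen i) xi) (fun u => below (wlength (wmul (sgen i) w)) (hW M (sgen i) u))).
    by apply: preim_subsp; [exact: (lW hM)|exact: below_sub].
  move=> u [w' /andP[ow' lw'] ->]; apply: span_gen; exists (wmul (sgen i) w'); last by rewrite (hWM hM).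
  rewrite okWM ?okW_sgen //=; apply: leq_ltn_trans (wlength_sgen_le N2 i w') _.
  by apply: leq_ltn_trans lt.
- move=> ff w IH xi; rewrite !(hWM hM) (actT_hpi hM) // wact_dualM wlength_pi //.
  have -> : ev (wact_dual piW (wz w)) xi = ev (wz w) (wact_t (winv piW) xi).
    by rewrite -{1}(wact_tVK piW xi) ev_wact.
  rewrite -(linZ (lW hM _)) -(linB (lW hM _)).
  apply: (IH (wact_t (winv piW) xi) (fun u => below (wlength w) (hW M piW u))).
    by apply: preim_subsp; [exact: (lW hM)|exact: below_sub].
  move=> u [w' /andP[ow' lw'] ->]; apply: span_gen; exists (wmul piW w'); last by rewrite (hWM hM).
  by rewrite /okW ff wlength_pi.
- move=> ff w IH xi; rewrite !(hWM hM) (actT_hpiV hM) // wact_dualM wlength_piV //.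
  have -> : ev (wact_dual (winv piW) (wz w)) xi = ev (wz w) (wact_t piW xi).
    by rewrite -{1}(wact_tK piW xi) ev_wact.
  rewrite -(linZ (lW hM _)) -(linB (lW hM _)).
  apply: (IH (wact_t piW xi) (fun u => below (wlength w) (hW M (winv piW) u))).
    by apply: preim_subsp; [exact: (lW hM)|exact: below_sub].
  move=> u [w' /andP[ow' lw'] ->]; apply: span_gen; exists (wmul (winv piW) w'); last by rewrite (hWM hM).
  by rewrite /okW ff wlength_piV.
Qed.

Definition hspan v := lspan (fun u => exists2 w, okW full w & u = hW M w one) v.

Lemma hspan_sub : subsp hspan. Proof. exact: span_subsp. Qed.

Lemma hspan_one : hspan one.
Proof. by apply: span_gen; exists wone; rewrite ?okW1 ?(hW1 hM). Qed.

Lemma hspan_W w v : okW full w -> hspan v -> hspan (hW M w v).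
Proof.
move=> ow hv; apply: (hv (fun u => hspan (hW M w u))).
  by apply: preim_subsp hspan_sub; exact: (lW hM).
move=> u [w' ow' ->]; apply: span_gen; exists (wmul w w'); first exact: okWM.
by rewrite (hWM hM).
Qed.

Lemma hspan_actT xi v : hspan v -> hspan (actT M xi v).
Proof.
move=> hv; apply: (hv (fun u => hspan (actT M xi u))).
  by apply: preim_subsp hspan_sub; exact: (lin_actT hM).
move=> u [w ow ->]; rewrite -[actT _ _ _](subrK (ev (wz w) xi *: hW M w one)).
have [_ SD SZ] := hspan_sub; apply: SD; last by apply: SZ; apply: span_gen; exists w.
move=> Q sQ SQ; apply: (triangular ow xi) => // u' [w' /andP[ow' _] ->].
by apply: SQ; exists w'.
Qed.

Lemma hspan_X i v : hspan v -> hspan (hX M i v).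
Proof. by rewrite -actT_tbasis; apply: hspan_actT. Qed.

Lemma hspan_phi i v : okS full i -> hspan v -> hspan (phi_gen M i v).
Proof.
move=> oi hv; have [_ SD _] := hspan_sub; apply: SD => //.
by apply: hspan_W; [apply: okW_sgen|apply: hspan_actT].
Qed.

(** That c commutes with the group is not among the axioms of [is_pmod]; it follows from the
    relations for xi = c, which the group fixes and every alpha_i kills. *)
Lemma hspan_C v : hspan v -> hC M v = z0.2 *: v.
Proof.
move=> hv; apply: (hv (fun u => hC M u = z0.2 *: u)).
  split=> [|u w e e'|a u e]; first by rewrite (lin0 (lC hM)) scaler0.
    by rewrite (linD (lC hM)) e e' scalerDr.
  by rewrite (linZ (lC hM)) e !scalerA mulrC.
have cE u : hC M u = actT M ([ffun => 0], 1) u.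
  by rewrite /actT big1 ?add0r ?scale1r // => j _; rewrite ffunE scale0r.
have cW : forall (w : W N) (xi : tvec F N), xi.1 = [ffun => 0] -> wact_t w xi = xi.
  move=> w xi x0; apply: tdual_eqP => [|j] /=; last by rewrite ffunE x0 !ffunE.
  by rewrite big1 ?subr0 // => j _; rewrite ffunE x0 !ffunE mulr0.
have aC i : alpha_of i ([ffun => 0], 1) = 0 :> F.
  by rewrite /alpha_of; case: ifP => _; rewrite !ffunE subrr.
move=> u [w ow ->]; move: w ow; apply: (W_ind N2).
- by rewrite (hW1 hM); case: hrel.
- move=> i w oi ow IH _; rewrite (hWM hM) cE (actT_hs N2 hM) // cW // -cE IH aC scale0r subr0.
  by rewrite (linZ (lW hM _)).
- by move=> ff w IH; rewrite (hWM hM) cE (actT_hpi hM) // cW // -cE IH (linZ (lW hM _)).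
- by move=> ff w IH; rewrite (hWM hM) cE (actT_hpiV hM) // cW // -cE IH (linZ (lW hM _)).
Qed.

(** Induction on length. A non-minimal w is replaced by the shorter w s_p, with the same vector w.1.
    For a minimal w other than 1 some coordinate i separates [zb] from w(zeta), and X_i minus the
    coordinate of w(zeta) is an admissible factor that sends w.1 to shorter vectors. *)
Lemma hspan_carried (zb : {ffun 'I_N -> F}) :
  (forall w, okW full w -> minrep sel w -> w != wone -> (wz w).1 != zb) ->
  forall v, hspan v -> carried M zb (fun u => exists c, u = c *: one) v.
Proof.
move=> hz v hv; set D := fun u => _.
have sD : subsp D by exact: line_subsp.
have DX i u : D u -> D (hX M i u).
  move=> [c ->]; exists (c * z0.1 i); rewrite (linZ (lX hM i)) wt_one.1 !scalerA //.
have sE := carried_subsp hM zb sD DX.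
apply: hv => // u [w ow ->] {v u}.
have [n] := ubnP (wlength w); elim: n w ow => // n IH w ow ln.
have IHb v : below (wlength w) v -> carried M zb D v.
  move=> h; apply: h => // u [w' /andP[ow' lw'] ->]; apply: IH => //.
  by apply: leq_trans lw' _; rewrite -ltnS.
have [mw|/minrepPn[p [p0 sp np]]] := boolP (minrep sel w); last first.
  have -> : hW M w one = hW M (wmul w (sgen p)) one.
    by rewrite (hWM hM); case: hrel => h _ _; rewrite (h (sgen p)) //; apply: in_Wbar_sgen.
  apply: IH; last by apply: leq_trans (wlength_mulr_lt N2 np) _; rewrite -ltnS.
  by apply: okWM => //; apply: okW_sgen; rewrite /okS p0 orbT.
have [->|w1] := eqVneq w wone.
  by apply: carried_base; exists 1; rewrite (hW1 hM) scale1r.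
have /eqP nz := hz w ow mw w1.
have /existsP[i hi] : [exists i, zb i != (wz w).1 i].
  apply/existsPn => h; apply: nz; apply/ffunP => i.
  by have := h i; rewrite negbK => /eqP.
apply: (carried_step hi); apply: IHb.
by have := triangular ow (tbasis F i); rewrite actT_tbasis ev_tbasis.
Qed.

Lemma wt_line z v : hspan v -> wt M z v ->
  (forall w, okW full w -> minrep sel w -> w != wone -> (wz w).1 != z.1) ->
  exists c, v = c *: one.
Proof.
move=> hv wv hz; have := hspan_carried hz hv.
by apply: (carried_wt hM (line_subsp one) (erefl z.1) wv).
Qed.

(** The stabilizer being trivial, w(zeta) differs from w'(zeta) for every minimal w', so v is a
    multiple of 1. If v were nonzero, w(zeta) would agree with zeta on \bar t, forcing w = 1, which
    is minimal. *)
Lemma wt_not_minrep w v : okW full w -> ~~ minrep sel w -> hspan v -> wt M (wz w) v -> v = 0.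
Proof.
move=> ow nm hv wv; have [|c vE] := wt_line hv wv.
  move=> w' ow' mw' _; apply: contraNneq nm => e.
  by rewrite -(wact_inj htd hgen hc ow' ow e).
apply/eqP/idPn => v0; case/negP: nm.
suff -> : w = wone by exact: minrep1.
apply: (wact_stab htd hgen hc ow); apply/ffunP => i.
have := wv.1 i; rewrite {1}vE (linZ (lX hM i)) wt_one.1 scalerA mulrC -scalerA -vE.
by move=> /eqP; rewrite -subr_eq0 -scalerBl scaler_eq0 (negPf v0) orbF subr_eq0 => /eqP ->.
Qed.

Inductive Reach : W N -> V -> Prop :=
| Reach_one : Reach wone one
| Reach_phi w v i : okS full i -> pz (wz w) (sroot i) != 1 -> pz (wz w) (sroot i) != -1 ->
    Reach w v -> Reach (wmul (sgen i) w) (phi_gen M i v)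
| Reach_pi w v : full -> Reach w v -> Reach (wmul piW w) (hW M piW v)
| Reach_piV w v : full -> Reach w v -> Reach (wmul (winv piW) w) (hW M (winv piW) v).

Lemma ReachP w v : Reach w v -> [/\ okW full w, wt M (wz w) v, minrep sel w & hspan v].
Proof.
elim=> {w v} [|w v i oi n1 nm _ [ow wv mw hv]|w v ff _ [ow wv mw hv]|w v ff _ [ow wv mw hv]].
- by rewrite wact_dual1; split; [exact: okW1|exact: wt_one|exact: minrep1|exact: hspan_one].
- split; first by apply: okWM => //; apply: okW_sgen.
  + by rewrite wact_dualM; apply: (wt_phi N2 hM).
  (* Losing minimality would make alpha_i the image of a simple block root, hence the pairing -1,
     which [Reach_phi] excludes. *)
  + apply/idPn => /(minrep_sgen N2 mw)[p [p0 sp wp]]; case/negP: nm.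
    rewrite -wp pz_wact (pz_block htd (sroot_inR p0 sp)) /sroot (negPf p0) /=.
    by have -> : (p - p.-1 = 1)%N by move: p0 => /=; lia.
  + exact: hspan_phi.
- split; first by rewrite /okW ff.
  + by rewrite wact_dualM; apply: (wt_pi hM).
  + by apply/forallP => p; apply/implyP => hp; rewrite wrM rpos_pi //; move/forallP/(_ p)/implyP: mw; apply.
  + by apply: hspan_W => //; rewrite /okW ff.
- split; first by rewrite /okW ff.
  + by rewrite wact_dualM; apply: (wt_piV hM).
  + by apply/forallP => p; apply/implyP => hp; rewrite wrM rpos_piV //; move/forallP/(_ p)/implyP: mw; apply.
  + by apply: hspan_W => //; rewrite /okW ff.
Qed.

Lemma one_sqr_neq0 (m : F) : m != 1 -> m != -1 -> 1 - m ^+ 2 != 0.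
Proof.
move=> m1 m2; rewrite subr_eq0 eq_sym sqrf_eq1 negb_or m1; exact: m2.
Qed.

Definition stable Q := [/\ subsp Q, forall i v, Q v -> Q (hX M i v),
  forall i v, okS full i -> Q v -> Q (hW M (sgen i) v),
  full -> forall v, Q v -> Q (hW M piW v) & full -> forall v, Q v -> Q (hW M (winv piW) v)].

Lemma stable_phi Q z i v : stable Q -> okS full i -> wt M z v -> Q v -> Q (phi_gen M i v).
Proof.
move=> [[_ QD QZ] _ Qs _ _] oi wv Qv; rewrite (phi_wt hM i wv).
by apply: QD => //; apply: QZ; apply: Qs.
Qed.

(** Each step can be undone inside Q: applying phi_i again multiplies the previous vector by 1 -
    m^2, where m is the pairing, and m is neither 1 nor -1. *)
Lemma Reach_back Q w v : stable Q -> Reach w v -> Q v -> Q one.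
Proof.
move=> sQ; elim=> {w v} // [w v i oi n1 nm R IH|w v ff _ IH|w v ff _ IH] Qv; apply: IH.
- have [_ wv _ _] := ReachP R.
  apply: (subspZ (a := 1 - pz (wz w) (sroot i) ^+ 2)).
  + by case: sQ.
  + exact: one_sqr_neq0.
  + by rewrite -(phi_phi N2 hM oi wv); apply: stable_phi Qv => //; apply: (wt_phi N2 hM oi wv).
- by rewrite -(hWVK hM piW v); case: sQ => _ _ _ _; apply.
- by rewrite -(hWK hM piW v); case: sQ => _ _ _ + _; apply.
Qed.

Lemma zero_stable : stable (fun v => v = 0).
Proof.
split=> [|i v ->|i v _ ->|_ v ->|_ v ->]; try by rewrite lin0 //; (exact: (lX hM) || exact: (lW hM)).
by split=> [|u v -> ->|a u ->]; rewrite ?addr0 ?scaler0.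
Qed.

Lemma Reach_neq0 w v : one <> 0 -> Reach w v -> v <> 0.
Proof. by move=> n0 R v0; apply: n0; apply: (Reach_back zero_stable R v0). Qed.

(** The last intertwiner brings v' back to the preceding weight, where the claim holds by induction;
    applying it once more returns a nonzero multiple of v'. At w = 1 the claim is [wt_line]. *)
Lemma Reach_line w v v' : Reach w v -> hspan v' -> wt M (wz w) v' -> exists c, v' = c *: v.
Proof.
move=> R; elim: R v' => {w v} [|w v i oi n1 nm R IH|w v ff _ IH|w v ff _ IH] v' hv'.
- rewrite wact_dual1 => wv'; apply: (wt_line hv' wv') => w ow _.
  by apply: contraNneq => e; apply/eqP; apply: (wact_stab htd hgen hc ow e).
- rewrite wact_dualM => wv'.
  have [|c hcv] := IH (phi_gen M i v') (hspan_phi oi hv').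
    by rewrite -[wz w](wact_dual1) -(sgenK N2 i) wact_dualM; apply: (wt_phi N2 hM).
  have := phi_phi N2 hM oi wv'; rewrite hcv.
  have [_ wv _ _] := ReachP R.
  rewrite (phi_wt hM i (wtZ hM c wv)) (linZ (lW hM _)) scalerA [_ * c]mulrC -scalerA -scalerDr.
  rewrite -(phi_wt hM i wv) pz_wactV winv_sgen // wr_sroot // pz_opp sqrrN.
  have d0 := one_sqr_neq0 n1 nm; set d := 1 - _ in d0 * => e.
  exists (d^-1 * c); rewrite -scalerA e scalerA mulVf ?scale1r //.
- rewrite wact_dualM => wv'; have [| |c e] := IH (hW M (winv piW) v').
  + by apply: hspan_W => //; rewrite /okW ff.
  + by have := wt_piV hM ff wv'; rewrite wact_dualK.
  by exists c; rewrite -(linZ (lW hM _)) -e (hWK hM).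
- rewrite wact_dualM => wv'; have [| |c e] := IH (hW M piW v').
  + by apply: hspan_W => //; rewrite /okW ff.
  + by have := wt_pi hM ff wv'; rewrite -wact_dualM wmulwV wact_dual1.
  by exists c; rewrite -(linZ (lW hM _)) -e (hWVK hM).
Qed.

(** By resonance w^{-1}(alpha_i) is, up to sign, a positive block root. The sign is plus, as w is
    minimal; so s_i w sends a positive block root to -alpha_i, is not minimal, and its weight does
    not occur. *)
Lemma Reach_phi0 w v i : okS full i -> Reach w v ->
  (pz (wz w) (sroot i) == 1) || (pz (wz w) (sroot i) == -1) -> phi_gen M i v = 0.
Proof.
move=> oi R; have [ow wv mw hv] := ReachP R; rewrite pz_wactV => res.
have okr : okR full (wr (winv w) (sroot i)) by apply: okR_wr (okWV ow) (okR_sroot oi).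
have ir : isroot (wr (winv w) (sroot i)) by rewrite wr_isroot sroot_isroot.
apply: (@wt_not_minrep (wmul (sgen i) w)); last by rewrite wact_dualM; apply: (wt_phi N2 hM).
- by apply: okWM => //; apply: okW_sgen.
- have [rR|rR] := pz_resonant hgen okr ir res.
    apply/negP => /minrepP/(_ rR); rewrite wrM wrVK wr_sroot // rpos_opp ?sroot_isroot //.
    by rewrite sroot_pos.
  by have := minrepP mw rR; rewrite wr_opp wrVK rpos_opp ?sroot_isroot // sroot_pos.
- exact: hspan_phi.
Qed.

(** On a reached vector u, phi_i u = u + m s_i u with m nonzero by genericity, so s_i u is a
    combination of u and phi_i u; the latter is either reached or zero. *)
Lemma hspan_Reach v : hspan v -> lspan (fun u => exists w, Reach w u) v.
Proof.
set S := fun u => _; have sS := span_subsp S; have [S0 SD SZ] := sS.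
move=> hv; apply: hv => // u [w ow ->]; move: w ow; apply: (W_ind N2).
- by rewrite (hW1 hM); apply: span_gen; exists wone; constructor.
- move=> i w oi ow IH _; rewrite (hWM hM).
  apply: (IH (fun u => lspan S (hW M (sgen i) u))); first by apply: preim_subsp => //; exact: (lW hM).
  move=> {}u [{IH ow}w R]; have [ow wv mw hv] := ReachP R.
  have m0 : pz (wz w) (sroot i) != 0.
    rewrite pz_wactV; apply: (pz_neq0 htd hgen).
      exact: okR_wr (okWV ow) (okR_sroot oi).
    by rewrite wr_isroot sroot_isroot.
  apply: (subspZ sS m0); have -> : pz (wz w) (sroot i) *: hW M (sgen i) u = phi_gen M i u - u.
    by rewrite (phi_wt hM i wv) addrC addKr.
  apply: (subspB sS); last by apply: span_gen; exists w.
  case res: ((pz (wz w) (sroot i) == 1) || (pz (wz w) (sroot i) == -1)).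
    by rewrite (Reach_phi0 oi R res).
  move/negbT: res; rewrite negb_or => /andP[n1 nm].
  by apply: span_gen; exists (wmul (sgen i) w); constructor.
- move=> ff w IH; rewrite (hWM hM).
  apply: (IH (fun u => lspan S (hW M piW u))); first by apply: preim_subsp => //; exact: (lW hM).
  by move=> {}u [w' R]; apply: span_gen; exists (wmul piW w'); constructor.
- move=> ff w IH; rewrite (hWM hM).
  apply: (IH (fun u => lspan S (hW M (winv piW) u))); first by apply: preim_subsp => //; exact: (lW hM).
  by move=> {}u [w' R]; apply: span_gen; exists (wmul (winv piW) w'); constructor.
Qed.

(** Shortening of a combination q: if q is not of the weight of its first term, some X_i - c
    vanishes on that term and not on q, and acts on the other terms by scalars. Otherwise q is a
    multiple of its first term by [Reach_line], and [Reach_back] concludes. *)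
Lemma stable_sum Q (s : seq (F * V)) : stable Q -> (forall p, p \in s -> exists w, Reach w p.2) ->
  Q (\sum_(p <- s) p.1 *: p.2) -> \sum_(p <- s) p.1 *: p.2 <> 0 -> Q one.
Proof.
move=> sQ; have [ssQ QX _ _ _] := sQ.
have [n] := ubnP (size s); elim: n s => // n IH [|[c0 v0] s] /= hn hs; first by rewrite big_nil.
set q := \sum_(p <- _) _ => Qq q0.
have [w0 R0] := hs (c0, v0) (mem_head _ _); have [ow wv0 _ hv0] := ReachP R0.
have hq : hspan q.
  by apply: (subsp_sum hspan_sub) => p /hs[w /ReachP[_ _ _ h]]; case: hspan_sub => _ _; apply.
have [/forallP hall|/forallPn[i hi]] :=
    boolP [forall i, hX M i q - (wz w0).1 i *: q == 0].
  have [|c qE] := Reach_line R0 hq.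
    split=> [i|]; first by apply/eqP; rewrite -subr_eq0.
    exact: hspan_C.
  apply: (Reach_back sQ R0); apply: (subspZ ssQ (a := c)); last by rewrite -qE.
  by apply/eqP => c00; apply: q0; rewrite qE c00 scale0r.
have key (t : seq (F * V)) : (forall p, p \in t -> exists w, Reach w p.2) ->
   exists2 t' : seq (F * V), (forall p, p \in t' -> exists w, Reach w p.2) /\ size t' = size t
     & \sum_(p <- t') p.1 *: p.2 =
       hX M i (\sum_(p <- t) p.1 *: p.2) - (wz w0).1 i *: (\sum_(p <- t) p.1 *: p.2).
  elim: t => [|[c v] t IHt] ht; first by exists [::] => //; rewrite !big_nil (lin0 (lX hM i)) scaler0 subrr.
  have [|t' [ht' st'] et'] := IHt; first by move=> p pt; apply: ht; rewrite inE pt orbT.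
  have [w R] := ht (c, v) (mem_head _ _); have [_ wv _ _] := ReachP R.
  exists ((c * ((wz w).1 i - (wz w0).1 i), v) :: t').
    split; last by rewrite /= st'.
    by move=> p; rewrite inE => /orP[/eqP->|/ht' //]; exists w.
  rewrite !big_cons et' /= (linD (lX hM i)) (linZ (lX hM i)) wv.1.
  rewrite scalerDr opprD addrACA; congr +%R.
  by rewrite !scalerA -scalerBl; congr (_ *: _); ring.
have [t [ht st] et] := key s (fun p ps => hs p (mem_behead (s := (c0, v0) :: s) ps)).
have etq : \sum_(p <- t) p.1 *: p.2 = hX M i q - (wz w0).1 i *: q.
  rewrite et /q big_cons /= (linD (lX hM i)) (linZ (lX hM i)) wv0.1.
  by rewrite scalerDr opprD addrACA !scalerA [_ * c0]mulrC subrr add0r.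
apply: (IH t) => //; rewrite ?st //.
- rewrite etq; apply: (subspB ssQ); first exact: QX.
  by case: ssQ => _ _; apply.
- by rewrite etq; apply/eqP.
Qed.

Lemma stable_one Q q : stable Q -> hspan q -> Q q -> q <> 0 -> Q one.
Proof.
move=> sQ hq Qq q0.
pose P u := exists2 s : seq (F * V), (forall p, p \in s -> exists w, Reach w p.2)
     & u = \sum_(p <- s) p.1 *: p.2.
have [s hs qE] : P q.
  have := hspan_Reach hq; apply=> [|u [w R]].
    split=> [|u v [s hs ->] [t ht ->]|a u [s hs ->]].
    - by exists [::]; rewrite ?big_nil.
    - by exists (s ++ t); rewrite ?big_cat // => p; rewrite mem_cat => /orP[/hs|/ht].
    - exists [seq (a * p.1, p.2) | p <- s]; first by move=> p /mapP[p' /hs h ->].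
      by rewrite big_map scaler_sumr; apply: eq_bigr => p _; rewrite scalerA.
  exists [:: (1, u)]; last by rewrite big_seq1 scale1r.
  by move=> p; rewrite inE => /eqP->; exists w.
by rewrite qE in Qq q0; apply: (stable_sum sQ hs Qq q0).
Qed.

End CyclicModules.

(** * The index set X^beta *)

Section MinimalLength.
Variables (N : nat) (sel : 'I_N -> bool).
Hypothesis N2 : (2 <= N)%N.
Implicit Types (w y : W N) (r : aroot N).

Lemma sgen_nonblock p r : val p != 0%N -> sel p ->
  isroot r && rpos r && ~~ inR sel r ->
  let r' := wr (sgen p) r in isroot r' && rpos r' && ~~ inR sel r'.
Proof.
move=> p0 sp /andP[/andP[ir pr] nr] /=; rewrite wr_isroot ir /=.
have ne : r != sroot p by apply: contraNneq nr => ->; apply: sroot_inR.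
rewrite rpos_sgen //=; apply: contra nr.
have pp : sameblk sel (prevo p) p by case/and3P: (sroot_inR p0 sp); rewrite /sroot (negPf p0).
have st a : sameblk sel a (tperm (prevo p) p a).
  by case: tpermP => [->|->|_ _]; rewrite ?sameblk_refl // sameblk_sym.
case: r ir pr ne => [[a b] k] ir pr ne.
rewrite /inR /inRgp /wr /wroot /sgen (negPf p0) /= !ffunE subrr subr0 => /and3P[k0 _ sab].
have ab : sameblk sel a b.
  by apply: sameblk_trans (st a) (sameblk_trans sab _); rewrite sameblk_sym.
rewrite k0 ab andbT; move: pr; rewrite /rpos /rootpos /= (eqP k0) /=; lia.
Qed.

(** \bar W_beta preserves the set of positive roots outside the blocks, and S(w) lies in that set
    when w is minimal; so y^{-1} embeds S(w) into S(w y). *)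
Lemma minrep_wlength w y : minrep sel w -> in_Wbar_gamma sel y ->
  (wlength w <= wlength (wmul w y))%N.
Proof.
move=> mw [js [sjs yE]].
have yV r : isroot r && rpos r && ~~ inR sel r ->
    isroot (wr (winv y) r) && rpos (wr (winv y) r) && ~~ inR sel (wr (winv y) r).
  rewrite yE {yE}; elim: js sjs r => [|p js IH] /=.
    by move=> _ r; rewrite winv1 wr1.
  move=> /andP[/andP[p0 sp] /IH {}IH] r hr.
  by rewrite winvM winv_sgen // wrM; apply: IH; apply: sgen_nonblock.
rewrite !wlength_size -(size_map (wr (winv y))); apply: uniq_leq_size.
  by rewrite map_inj_uniq ?Slist_uniq //; exact: wr_inj.
move=> _ /mapP[r rS ->]; move: rS; rewrite !mem_Slist => /and3P[ir pr nr].
have nR : ~~ inR sel r by apply: contra nr; apply: minrepP.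
by have := yV r; rewrite ir pr nR => /(_ isT)/andP[/andP[-> ->] _]; rewrite wrM wrVK.
Qed.

End MinimalLength.

Section IndexSet.
Variables (N : nat) (beta : seq nat).
Hypothesis N2 : (2 <= N)%N.
Implicit Types (x w : W N) (i j a b : 'I_N) (u : 'S_N).
Local Notation sel := (@selP N beta).
Local Notation bk := (blk beta).

Lemma blk_mono p q : (p <= q)%N -> (bk p <= bk q)%N.
Proof.
move=> pq; apply: leq_sum => k _; set s := (\sum_(l < _) _)%N.
by case: (leqP s p) => // sp; rewrite (leq_trans sp pq).
Qed.

Lemma selPE i : val i != 0%N -> sel i = (bk (prevo i) == bk i).
Proof. by rewrite /selP => ->. Qed.

Lemma sameblk_blk a b : sameblk sel a b = (bk a == bk b).
Proof.
wlog ab : a b / (a < b)%N => [h|].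
  case: (ltngtP a b) => [|/h e|e]; first exact: h.
    by rewrite sameblk_sym eq_sym.
  by have -> : a = b by [apply: val_inj]; rewrite sameblk_refl eqxx.
apply/idP/eqP => [|e].
  apply: (sameblk_ind (R := fun a b => bk a = bk b)) ab => [i i0|p q r _ _ -> //].
  by rewrite selPE // => /eqP.
apply/sameblkP => j hj; rewrite /selP; apply/andP; split; first by move: hj ab => /=; lia.
have h1 : (bk a <= bk j.-1)%N by apply: blk_mono; move: hj ab; lia.
have h2 : (bk j <= bk b)%N by apply: blk_mono; move: hj ab; lia.
have h3 : (bk j.-1 <= bk j)%N by apply: blk_mono; lia.
by move: h1 h2 h3 e; lia.
Qed.

(** A local form of membership in X^beta: since eta_w jumps by 1 exactly where the block number of
    u^{-1} increases, eta - eta_w is antidominant if and only if eta is weakly increasing, and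
    strictly so at those places. *)
Definition xcond x : Prop :=
  (forall a b, (a < b)%N -> bk a = bk b -> (x.1 a < x.1 b)%N) /\
  (forall i, val i != 0%N -> x.2 (prevo i) <= x.2 i /\
     (x.2 (prevo i) = x.2 i -> (bk ((x.1^-1)%g i) <= bk ((x.1^-1)%g (prevo i)))%N)).

Lemma minrep_perm u : minrep sel (u, [ffun => 0]) <->
  (forall a b, (a < b)%N -> bk a = bk b -> (u a < u b)%N).
Proof.
split=> [mu a b ab e|h].
  have : inR sel (a, b, 0) by rewrite /inR /inRgp /= ab sameblk_blk e eqxx.
  by move=> /(minrepP mu); rewrite /rpos /rootpos /wr /wroot /= !ffunE; lia.
apply/forallP => p; apply/implyP => /andP[p0 sp].
rewrite /sroot (negPf p0) /rpos /rootpos /wr /wroot /= !ffunE h //; first by move: p0 => /=; lia.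
by apply/eqP; rewrite -selPE.
Qed.

Definition brk u i := [exists a : 'I_N, exists b : 'I_N,
  [&& (val a < val b)%N, ~~ sameblk sel a b, u a == prevo i & u b == i]].

Lemma brkE u i : brk u i = (bk ((u^-1)%g (prevo i)) < bk ((u^-1)%g i))%N.
Proof.
apply/existsP/idP => [[a /existsP[b /and4P[ab nab /eqP<- /eqP<-]]]|h].
  rewrite !permK ltn_neqAle -sameblk_blk nab /=; exact: blk_mono (ltnW ab).
exists ((u^-1)%g (prevo i)); apply/existsP; exists ((u^-1)%g i).
rewrite !permKV !eqxx sameblk_blk !andbT.
apply/andP; split; last by move: h; lia.
by rewrite ltnNge; apply/negP => /blk_mono; move: h => /=; lia.
Qed.

Lemma in_X_xcond x : in_X sel x -> xcond x.
Proof.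
move=> [u [eta0 [etaw [[hu _] he0 [_ hew] ->]]]]; split=> /= [|i i0].
  apply/minrep_perm; apply/idPn => /minrepPn[p [p0 sp np]].
  have := hu _ (in_Wbar_sgen p0 sp); rewrite leqNgt => /negP; apply.
  exact: wlength_mulr_lt.
have h0 : eta0 (prevo i) <= eta0 i by apply: he0; move: i0 => /=; lia.
have := hew i i0; rewrite -/(brk u i) brkE !ffunE.
by case: leqP => [|] hb hd; split; lia.
Qed.

Lemma xcond_in_X x : xcond x -> in_X sel x.
Proof.
move=> [inc adj]; pose u := x.1.
(* The recursion that defines eta_w, started at 0, is solved by counting the breaks up to j. *)
pose etaw : {ffun 'I_N -> int} :=
  [ffun j : 'I_N => \sum_(i < N | (0 < i <= j)%N) (nat_of_bool (brk u i))%:Z].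
have ew i : val i != 0%N -> etaw (prevo i) - etaw i = if brk u i then -1 else 0.
  move=> i0; rewrite !ffunE [X in _ - X](bigD1 i) /=; last by move: i0 => /=; lia.
  rewrite opprD addrCA -[RHS]addr0; congr +%R; first by case: brk.
  apply/eqP; rewrite subr_eq0; apply/eqP; apply: eq_bigl => j.
  by move: i0; rewrite -val_eqE /=; lia.
exists u, [ffun j => x.2 j - etaw j], etaw; split.
- split=> // y hy; apply: (minrep_wlength N2 _ hy); exact/minrep_perm.
- apply: (adj_increasing N2 (R := fun p q : int => p <= q)).
    by move=> p q r; apply: le_trans.
  move=> i i0; rewrite ![[ffun j => x.2 j - etaw j] _]ffunE.
  have := ew i i0; have [h1 h2] := adj i i0; rewrite brkE.
  by case: ltnP => hb; move: h1 h2 hb; rewrite -/u; lia.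
- split; last exact: ew.
  by move=> i i0; rewrite ffunE big1 // => j; rewrite i0; lia.
- by apply: W_eqP => // j; rewrite !ffunE subrK.
Qed.

Lemma xcond_mono x a b : xcond x -> (a < b)%N -> x.2 a <= x.2 b.
Proof.
move=> [_ adj]; apply: (adj_increasing N2 (R := fun p q : int => p <= q)).
  by move=> p q r; apply: le_trans.
by move=> i /adj[].
Qed.

Lemma xcond_minrep x : xcond x -> minrep sel x.
Proof.
move=> xc; have [inc _] := xc; apply/forallP => p; apply/implyP => /andP[p0 sp].
have lt : (x.1 (prevo p) < x.1 p)%N.
  by apply: inc; [move: p0 => /=; lia|apply/eqP; rewrite -selPE].
have le := xcond_mono xc lt.
by rewrite /sroot (negPf p0) /rpos /rootpos /wr /wroot /= lt /=; apply/orP; left; lia.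
Qed.

(** An index strictly between the two ends of the block root would, u being increasing on blocks, be
    sent strictly between two consecutive positions. *)
Lemma selB_simple x i : xcond x -> selB sel x i ->
  exists p, [/\ val p != 0%N, sel p & wr x (sroot p) = (prevo i, i, 0)].
Proof.
move=> [inc _] /andP[i0 /existsP[a /existsP[b /andP[/and3P[_ ab sab] /eqP wE]]]].
rewrite sameblk_blk in sab; move/eqP: sab => sab.
have [ua ub] : x.1 a = prevo i /\ x.1 b = i by move: wE; rewrite /wroot => -[].
have ba : (b = a.+1 :> nat).
  apply/eqP; rewrite eqn_leq ab andbT leqNgt; apply/negP => h.
  have hc : (a.+1 < N)%N by have := ltn_ord b; move: h; lia.
  pose c := Ordinal hc.
  have m1 : (bk a <= bk c)%N by apply: blk_mono => /=.
  have m2 : (bk c <= bk b)%N by apply: blk_mono => /=; apply: ltnW.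
  have := inc a c (ltnSn a); have := inc c b h; rewrite ua ub /=; move: i0 m1 m2 => /=; lia.
have b0 : val b != 0%N by rewrite /= ba.
have pb : prevo b = a by apply: val_inj; rewrite /= ba.
exists b; split=> //; first by rewrite selPE // pb sab.
by rewrite /sroot (negPf b0) pb.
Qed.

(** Between a and b the translation coordinates are monotone with equal ends, hence constant; the
    block numbers are then weakly decreasing with equal ends, hence constant too. So each simple
    root in between comes from a block root of beta. *)
Lemma selB_block x a b : xcond x -> (a < b)%N -> x.2 a = x.2 b ->
  bk ((x.1^-1)%g a) = bk ((x.1^-1)%g b) -> sameblk (selB sel x) a b.
Proof.
move=> xc ab eab bab; have [inc adj] := xc.
have mon (p q : 'I_N) : (p <= q)%N -> x.2 p <= x.2 q.
  by rewrite leq_eqVlt => /orP[/eqP/val_inj->//|/(xcond_mono xc)].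
have eqv (j : 'I_N) : (a <= j <= b)%N -> x.2 j = x.2 a.
  by move=> /andP[/mon h1 /mon h2]; lia.
have dec (j k : 'I_N) : (a <= j)%N -> (j < k)%N -> (k <= b)%N ->
    (bk ((x.1^-1)%g k) <= bk ((x.1^-1)%g j))%N.
  case: k => k hk /= aj; elim: k hk => // k IH hk jk kb.
  have hk' : (k < N)%N by lia.
  pose ok := Ordinal hk; pose ok' := Ordinal hk'.
  have [_ h] := adj ok isT.
  have pk : prevo ok = ok' by apply: val_inj.
  rewrite pk in h.
  have hk1 : (bk ((x.1^-1)%g ok) <= bk ((x.1^-1)%g ok'))%N.
    by apply: h; rewrite !eqv //=; lia.
  move: (jk); rewrite ltnS leq_eqVlt => /orP[/eqP jk'|jk'].
    by have -> : j = ok' by apply: val_inj.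
  by apply: leq_trans hk1 _; apply: IH => //; lia.
have cst (j : 'I_N) : (a <= j <= b)%N -> bk ((x.1^-1)%g j) = bk ((x.1^-1)%g a).
  move=> /andP[aj jb]; apply/eqP; rewrite eqn_leq.
  have [e|ja] := eqVneq j a; first by rewrite e leqnn.
  have [e|jb'] := eqVneq j b; first by rewrite e bab leqnn.
  have {}ja : (a < j)%N by move: ja; rewrite -val_eqE /=; lia.
  have {}jb' : (j < b)%N by move: jb'; rewrite -val_eqE /=; lia.
  by rewrite dec //= bab dec // ltnW.
apply/sameblkP => j hj; have j0 : val j != 0%N by move: hj => /=; lia.
have aj : (a <= prevo j)%N by move: hj ab => /=; lia.
have jb : (j <= b)%N by move: hj ab => /=; lia.
have pj : (prevo j < j)%N by move: j0 => /=; lia.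
have h1 : (a <= prevo j <= b)%N by rewrite aj /= (leq_trans (leq_pred j)).
have h2 : (a <= j <= b)%N by rewrite jb andbT; move: aj pj => /=; lia.
rewrite /selB j0; apply/existsP; exists ((x.1^-1)%g (prevo j)); apply/existsP; exists ((x.1^-1)%g j).
have be : bk ((x.1^-1)%g (prevo j)) = bk ((x.1^-1)%g j) by rewrite !cst.
rewrite /inRgp eqxx sameblk_blk be eqxx andbT /=; apply/andP; split; last first.
  by rewrite /wroot !permKV !eqv // subrr subr0.
rewrite ltnNge leq_eqVlt; apply/negP => /orP[/eqP/val_inj/perm_inj e|h].
  by move: pj; rewrite -e ltnn.
by have := inc _ _ h (esym be); rewrite !permKV; move: pj => /=; lia.
Qed.

Definition key x j : int * nat * nat := (x.2 j, bk ((x.1^-1)%g j), nat_of_ord ((x.1^-1)%g j)).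
(** Lexicographic order, with the comparison of the natural numbers in the second slot reversed to
    account for the minus sign of the block number. *)
Definition keylt (p q : int * nat * nat) : bool :=
  (p.1.1 < q.1.1) || (p.1.1 == q.1.1) &&
   ((q.1.2 < p.1.2)%N || (p.1.2 == q.1.2) && (p.2 < q.2)%N).

Lemma xcond_key x a b : xcond x -> (a < b)%N -> keylt (key x a) (key x b).
Proof.
move=> [inc adj]; apply: (adj_increasing N2 (R := fun p q => keylt p q)).
  by move=> [[p1 p2] p3] [[q1 q2] q3] [[r1 r2] r3]; rewrite /keylt /=; lia.
move=> i i0; have [h1 h2] := adj i i0; rewrite /keylt /key /=.
case: (ltgtP (x.2 (prevo i)) (x.2 i)) h1 => //= e _.
have := h2 e; rewrite leq_eqVlt orbC => /orP[->//|/eqP be]; rewrite be eqxx /=; apply/orP; right.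
rewrite ltnNge leq_eqVlt; apply/negP => /orP[/eqP/val_inj/perm_inj e'|h].
  by move/(congr1 val): e' => /=; move: i0 => /=; lia.
by have := inc _ _ h be; rewrite !permKV /=; move: i0 => /=; lia.
Qed.

(** Left multiplication by s only moves the keys to new positions. Both x and x' list them in
    strictly increasing order, so s is increasing. *)
Lemma xcond_uniq x x' (s : 'S_N) : xcond x -> xcond x' ->
  x = wmul (s, [ffun => 0]) x' -> x = x'.
Proof.
move=> xc xc' xE; suff s1 : s = 1%g by rewrite xE s1; exact: wmul1w.
have kE j : key x (s j) = key x' j.
  by rewrite /key xE /= !ffunE /= add0r permK invMg permM permK.
apply: (perm_increasing_id N2) => i i0.
have pi : (prevo i < i)%N by move: i0 => /=; lia.
have := xcond_key xc' pi; rewrite -!kE; case: (ltngtP (s (prevo i)) (s i)) => [//|h|/val_inj->].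
  have := xcond_key xc h; rewrite /keylt; move: (key _ _) (key _ _) => [[? ?] ?] [[? ?] ?] /=; lia.
by rewrite /keylt; move: (key _ _) => [[? ?] ?] /=; lia.
Qed.

(** If two adjacent positions violate the order, either the translation coordinates drop, and
    w^{-1}(alpha_i) has k > 0, or they tie and the block number increases, and the root joins two
    different blocks in increasing order. In both cases phi_i is invertible there and raises the
    length. *)
Lemma xcond_or_ascent w : minrep sel w -> xcond w \/
  exists i, [/\ val i != 0%N, rpos (wr (winv w) (sroot i)) & ~~ inR sel (wr (winv w) (sroot i))].
Proof.
move=> mw.
pose bad i := (val i != 0%N) && ((w.2 i < w.2 (prevo i)) ||
  ((w.2 (prevo i) == w.2 i) && (bk ((w.1^-1)%g (prevo i)) < bk ((w.1^-1)%g i))%N)).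
have [/existsP[i /andP[i0 hi]]|/existsPn nb] := boolP [exists i, bad i].
  right; exists i; rewrite /sroot (negPf i0) /rpos /rootpos /inR /inRgp /wr /wroot /= !ffunE !permKV.
  rewrite sameblk_blk.
  have ne : (w.1^-1)%g (prevo i) != (w.1^-1)%g i.
    by rewrite (inj_eq perm_inj) -val_eqE /=; move: i0 => /=; lia.
  have m := @blk_mono ((w.1^-1)%g i) ((w.1^-1)%g (prevo i)).
  move: ne hi m; rewrite -val_eqE /=.
  move: (nat_of_ord ((w.1^-1)%g i)) (nat_of_ord ((w.1^-1)%g (prevo i))) => p q.
  move: (w.2 i) (w.2 (prevo i)) => c d.
  by move: (bk p) (bk q) => P Q ne hi m; split=> //; lia.
left.
have adj i : val i != 0%N -> w.2 (prevo i) <= w.2 i /\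
     (w.2 (prevo i) = w.2 i -> (bk ((w.1^-1)%g i) <= bk ((w.1^-1)%g (prevo i)))%N).
  by move=> i0; have := nb i; rewrite /bad i0 /=; lia.
have mono a b : (a < b)%N -> w.2 a <= w.2 b.
  apply: (adj_increasing N2 (R := fun p q : int => p <= q)).
    by move=> p q r; apply: le_trans.
  by move=> i /adj[].
split=> // a b ab e.
have : inR sel (a, b, 0) by rewrite /inR /inRgp /= ab sameblk_blk e eqxx.
move=> /(minrepP mw); rewrite /rpos /rootpos /wr /wroot /=.
have := mono (w.1 b) (w.1 a).
by move: (nat_of_ord (w.1 a)) (nat_of_ord (w.1 b)) (w.2 _) (w.2 _) => ????; lia.
Qed.

Variables (F : numClosedFieldType) (z : tdual F N).
Hypotheses (htd : in_tdual_gamma sel z) (hgen : pgeneric true sel z).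

Lemma xcond_tdual x : xcond x -> in_tdual_gamma (selB sel x) (wact_dual x z).
Proof.
move=> xc i i0 /(selB_simple xc)[p [p0 sp wp]].
have : pz (wact_dual x z) (prevo i, i, 0) = -1.
  rewrite -wp pz_wact -(htd p0 sp) /sroot (negPf p0) /pz /pair_root /=; ring.
by rewrite /pz /pair_root /= mul0r addr0.
Qed.

(** The roots resonant for x(zeta) are images under x of block roots up to sign; by [selB_block] the
    finite positive ones among them belong to the blocks of beta(x). *)
Lemma xcond_pgeneric x : xcond x -> pgeneric false (selB sel x) (wact_dual x z).
Proof.
move=> xc r; rewrite /okR /= => /eqP k0 ir pr nr.
rewrite pz_wactV; set r' := wr (winv x) r.
have ir' : isroot r' by rewrite wr_isroot.
have n0 := pz_neq0 htd hgen (r := r') isT ir'.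
suff : ~~ ((pz z r' == 1) || (pz z r' == -1)) by rewrite negb_or => /andP[-> ->]; split.
apply/negP => /(pz_resonant hgen (r := r') isT ir')[rR|rR]; last first.
  have := minrepP (xcond_minrep xc) rR; rewrite wr_opp wrVK rpos_opp //.
  by rewrite pr.
case/negP: nr; move: rR pr; rewrite /r'; case: r k0 {ir r' ir' n0} => [[a b] k] /= -> + pr.
have -> : wr (winv x) (a, b, 0) = ((x.1^-1)%g a, (x.1^-1)%g b, x.2 a - x.2 b).
  by rewrite /wr /wroot /= !ffunE !permKV; congr (_, _, _); ring.
rewrite /inR /inRgp /= => /and3P[/eqP e ab sab].
have lt : (a < b)%N by move: pr; rewrite /rpos /rootpos /=; lia.
rewrite lt /=; apply: selB_block => //; first by lia.
by apply/eqP; rewrite -sameblk_blk.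
Qed.

End IndexSet.

(** * A module in which the cyclic vector is nonzero *)

Section FreeModule.
Variables (F : numClosedFieldType) (K : choiceType).
Local Notation U := {malg F[K]}.
Implicit Types (p q : U) (k : K).

Lemma malgUZ (c : F) k : << c *g k >> = c *: << k >> :> U.
Proof. by apply/malgP => k'; rewrite mcoeffZ !mcoeffU; case: (k == k'); rewrite ?mulr1 ?mulr0. Qed.

Lemma malg_basis p : p = \sum_(k <- msupp p) p@_k *: << k >>.
Proof. by rewrite {1}[p]monalgE; apply: eq_bigr => k _; rewrite malgUZ. Qed.

Lemma lin_eq (T : lmodType F) (f g : U -> T) : lin f -> lin g ->
  (forall k, f << k >> = g << k >>) -> forall p, f p = g p.
Proof.
move=> lf lg e p; rewrite (malg_basis p) !lin_sum //; apply: eq_bigr => k _.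
by rewrite !linZ // e.
Qed.

Variables (T : lmodType F) (g : K -> T).
Definition lext p : T := \sum_(k <- msupp p) p@_k *: g k.

Lemma lextEw (d : {fset K}) p : (msupp p `<=` d)%fset -> lext p = \sum_(k <- d) p@_k *: g k.
Proof.
move=> le; rewrite /lext; apply: big_fset_incl => // k _ kp.
by rewrite (mcoeff_outdom kp) scale0r.
Qed.

Lemma lin_lext : lin lext.
Proof.
move=> a p q; pose d := (msupp p `|` msupp q `|` msupp (a *: p + q)%R)%fset.
rewrite !(@lextEw d); try by apply/fsubsetP => k kp; rewrite !in_fsetU kp ?orbT.
rewrite scaler_sumr -big_split /=; apply: eq_bigr => k _.
by rewrite mcoeffD mcoeffZ scalerDl scalerA.
Qed.

Lemma lextU k : lext << k >> = g k.
Proof.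
rewrite (@lextEw [fset k]%fset) ?msuppU_le // big_seq_fset1 mcoeffUU scale1r //.
Qed.

End FreeModule.

Section Reflections.
Variable N : nat.
Implicit Types (w x y : W N) (r : aroot N).

Definition srefl r : W N :=
  (tperm r.1.1 r.1.2, [ffun j => - r.2 * ((j == r.1.1)%:R - (j == r.1.2)%:R)]).

Lemma srefl_conj w r : isroot r -> wmul w (srefl r) = wmul (srefl (wr w r)) w.
Proof.
case: r => [[a b] k]; rewrite /isroot /= => ab; apply: W_eqP => [|j] /=.
  by rewrite -tpermJ conjgE mulKVg.
have [j' ->] : exists j', j = w.1 j' by exists (w.1^-1 j)%g; rewrite permKV.
rewrite !ffunE /= permK !(inj_eq perm_inj) tpermV.
have [->|ja] := eqVneq j' a; first by rewrite (negPf ab) tpermL /=; ring.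
have [->|jb] := eqVneq j' b; first by rewrite tpermR /=; ring.
by rewrite tpermD ?(inj_eq perm_inj) 1?eq_sym //=; ring.
Qed.

Lemma srefl_sroot i : srefl (sroot i) = sgen i.
Proof.
rewrite /srefl /sroot /sgen; case: ifP => i0 /=; congr pair; first by rewrite tpermC.
  apply/ffunP => j; rewrite !ffunE -!val_eqE /=; ring.
by apply/ffunP => j; rewrite !ffunE oppr0 mul0r.
Qed.

Lemma rpos_nil w : (forall r, rpos (wr w r) = rpos r) -> Slist w = [::].
Proof.
move=> h; case E: (Slist w) => [//|r s]; have : r \in Slist w by rewrite E mem_head.
by rewrite mem_Slist h => /and3P[_ ->].
Qed.

End Reflections.

(** * Dunkl operators on the free module C[W] *)

Section Model.
Variables (F : numClosedFieldType) (N : nat).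
Hypothesis N2 : (2 <= N)%N.
Variable z : tdual F N.
Variables (U : lmodType F) (e : W N -> U) (lext : (W N -> U) -> U -> U).
Hypotheses (lin_lext : forall g, lin (lext g)) (lextU : forall g w, lext g (e w) = g w)
  (lin_eq : forall f g : U -> U, lin f -> lin g -> (forall w, f (e w) = g (e w)) ->
     forall p, f p = g p).
Implicit Types (w x y : W N) (r : aroot N) (xi : tvec F N) (p : U).

Definition alr r xi : F := xi.1 r.1.1 - xi.1 r.1.2.

Lemma alr_wr w r xi : alr (wr w r) (wact_t w xi) = alr r xi.
Proof. by rewrite /alr /= !ffunE !permK. Qed.

Lemma alr_sroot i xi : alr (sroot i) xi = alpha_of i xi.
Proof. by rewrite /alr /sroot /alpha_of; case: ifP. Qed.

Lemma wact_t_sgen1 i xi j :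
  (wact_t (sgen i) xi).1 j = xi.1 j - alpha_of i xi * (coroot i).1 j.
Proof.
have := wact_dual_sgen N2 (xi.1, 0) i j; rewrite /= !ffunE mul0r addr0 => ->.
rewrite /pz /pair_root /= mulr0 addr0 -/(alr (sroot i) xi) alr_sroot.
by [].
Qed.

Definition mW x : U -> U := lext (fun w => (e (wmul x w))).

(** The value forced on xi.w.1 in the module induced from the character z of S[t']: commuting xi
    past w gives the diagonal term, and one reflection term for each positive root made negative by
    w^{-1}. *)
Definition dunkl xi w : U := ev (wact_dual w z) xi *: (e w) -
  \sum_(r <- Slist (winv w)) alr r xi *: (e (wmul (srefl r) w)).

Definition mD xi : U -> U := lext (dunkl xi).

Definition mops : Hops F N U := HOps mW (fun i => mD (tbasis F i)) (fun p => z.2 *: p).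

Lemma lin_mW x : lin (mW x). Proof. exact: lin_lext. Qed.
Lemma lin_mD xi : lin (mD xi). Proof. exact: lin_lext. Qed.

Lemma mWU x w : mW x (e w) = (e (wmul x w)). Proof. exact: lextU. Qed.
Lemma mDU xi w : mD xi (e w) = dunkl xi w. Proof. exact: lextU. Qed.

Lemma lin_comp (A B C : lmodType F) (f : B -> C) (g : A -> B) :
  lin f -> lin g -> lin (fun a => f (g a)).
Proof. by move=> lf lg a u v; rewrite lg lf. Qed.

Lemma lin_subf (A B : lmodType F) (f g : A -> B) :
  lin f -> lin g -> lin (fun a => f a - g a).
Proof. by move=> lf lg a u v; rewrite lf lg scalerBr opprD addrACA. Qed.

Lemma lin_scal (A B : lmodType F) (f : A -> B) (c : F) : lin f -> lin (fun a => c *: f a).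
Proof. by move=> lf a u v; rewrite lf scalerDr !scalerA mulrC. Qed.

Lemma lin_id (A : lmodType F) : lin (fun a : A => a). Proof. by []. Qed.

Lemma lin_comb (A : lmodType F) (I : Type) (s : seq I) (c : I -> F) (f : I -> A -> A) d :
  (forall i, lin (f i)) -> lin (fun v : A => \sum_(i <- s) c i *: f i v + d *: v).
Proof.
move=> lf a u v; rewrite [d *: _]scalerDr [a *: (_ + _)]scalerDr addrACA; congr +%R; last first.
  by rewrite !scalerA mulrC.
rewrite scaler_sumr -big_split /=; apply: eq_bigr => i _.
by rewrite lf scalerDr !scalerA mulrC.
Qed.

(* The scalar d accounts for the component of xi along c. *)
Lemma mD_comb (I : Type) (s : seq I) (c : I -> F) (eta : I -> tvec F N) xi d :
  (forall y : tdual F N, y.2 = z.2 -> ev y xi = \sum_(i <- s) c i * ev y (eta i) + d) ->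
  (forall r, alr r xi = \sum_(i <- s) c i * alr r (eta i)) ->
  forall p, mD xi p = \sum_(i <- s) c i *: mD (eta i) p + d *: p.
Proof.
move=> he ha; apply: lin_eq; first exact: lin_mD.
  by apply: lin_comb => i; exact: lin_mD.
move=> w; rewrite mDU; under eq_bigr do rewrite mDU /dunkl scalerBr scalerA scaler_sumr.
rewrite sumrB /dunkl he // scalerDl addrAC scaler_suml; congr (_ - _ + _).
rewrite exchange_big /=; apply: eq_bigr => r _.
by rewrite ha scaler_suml; apply: eq_bigr => i _; rewrite scalerA.
Qed.

Lemma actT_mops xi p : actT mops xi p = mD xi p.
Proof.
rewrite /actT /= (@mD_comb _ (index_enum _) (fun i => xi.1 i) (@tbasis F N) xi (xi.2 * z.2)).
- by rewrite scalerA.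
- by move=> y yz; rewrite /ev -yz; congr +%R; apply: eq_bigr => i _; rewrite -/(ev y (tbasis F i)) ev_tbasis.
- move=> r; rewrite /alr; under eq_bigr do rewrite !ffunE mulrBr ![_ * _%:R]mulrC.
  rewrite sumrB; congr (_ - _).
    by rewrite -[LHS](sum_delta r.1.1 xi.1); apply: eq_bigr => i _; rewrite eq_sym.
  by rewrite -[LHS](sum_delta r.1.2 xi.1); apply: eq_bigr => i _; rewrite eq_sym.
Qed.

Lemma mD_sgen i xi p :
  mD (wact_t (sgen i) xi) p = mD xi p - alpha_of i xi *: mD (coroot i) p.
Proof.
rewrite (@mD_comb _ [:: (1, xi); (- alpha_of i xi, coroot i)] (fun q => q.1) (fun q => q.2) _ 0).
- by rewrite big_cons big_seq1 /= scale1r scaleNr scale0r addr0.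
- move=> y _; rewrite big_cons big_seq1 /= ev_sgen // ev_coroot; ring.
- by move=> r; rewrite big_cons big_seq1 /= /alr !wact_t_sgen1; ring.
Qed.

Lemma Slist_winv_sgen i w : rpos (wr (winv w) (sroot i)) ->
  perm_eq (Slist (winv (wmul (sgen i) w))) (sroot i :: map (wr (sgen i)) (Slist (winv w))).
Proof.
move=> pw; have ir := sroot_isroot N2 i; have pr := sroot_pos N2 i.
have sK : involutive (wr (sgen i)) by move=> r; rewrite -wrM sgenK // wr1.
have mapE r : (r \in map (wr (sgen i)) (Slist (winv w))) = (wr (sgen i) r \in Slist (winv w)).
  by rewrite -{1}(sK r) mem_map //; exact: wr_inj.
apply: uniq_perm; first exact: Slist_uniq.
  rewrite /= map_inj_uniq ?Slist_uniq ?andbT ?mapE; last exact: wr_inj.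
  by rewrite mem_Slist wr_sroot // rpos_opp // pr andbF.
move=> r; rewrite inE mapE !mem_Slist winvM winv_sgen // wrM wr_isroot.
have [->|ne] := eqVneq r (sroot i).
  by rewrite ir pr wr_sroot // wr_opp rpos_opp ?wr_isroot // pw.
have [->|ne'] := eqVneq (wr (sgen i) r) (sroot i); first by rewrite pw !andbF.
case irr: (isroot r) => //=; congr (_ && _); apply/idP/idP => h; first exact: rpos_sgen.
by rewrite -[r]sK; apply: rpos_sgen; rewrite ?wr_isroot.
Qed.

Lemma mW_dunkl x xi w : mW x (dunkl xi w) = ev (wact_dual w z) xi *: (e (wmul x w)) -
  \sum_(r <- Slist (winv w)) alr r xi *: (e (wmul (srefl (wr x r)) (wmul x w))).
Proof.
rewrite /dunkl (linB (lin_mW x)) (linZ (lin_mW x)) mWU (lin_sum (lin_mW x)); congr (_ - _).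
rewrite big_seq [RHS]big_seq; apply: eq_bigr => r; rewrite mem_Slist => /andP[ir _].
by rewrite (linZ (lin_mW x)) mWU !wmulA srefl_conj.
Qed.

Lemma dunkl_sgen i xi w : rpos (wr (winv w) (sroot i)) ->
  mW (sgen i) (dunkl xi w) - dunkl (wact_t (sgen i) xi) (wmul (sgen i) w) = - alpha_of i xi *: (e w).
Proof.
move=> pw; rewrite mW_dunkl /dunkl wact_dualM ev_wact (perm_big _ (Slist_winv_sgen pw)) /=.
rewrite big_cons big_map alr_sroot alpha_of_sgen srefl_sroot wmulsK //.
have -> : \sum_(j <- Slist (winv w)) alr (wr (sgen i) j) (wact_t (sgen i) xi) *:
      (e (wmul (srefl (wr (sgen i) j)) (wmul (sgen i) w))) =
    \sum_(j <- Slist (winv w)) alr j xi *: (e (wmul (srefl (wr (sgen i) j)) (wmul (sgen i) w))).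
  by apply: eq_bigr => r _; rewrite alr_wr.
by apply/eqP; rewrite subr_eq opprD addrCA addNKr.
Qed.

Lemma mW_mul x y p : mW (wmul x y) p = mW x (mW y p).
Proof.
apply: (@lin_eq (mW (wmul x y)) (fun p => mW x (mW y p))); first exact: lin_mW.
  by apply: lin_comp; exact: lin_mW.
by move=> w; rewrite !mWU wmulA.
Qed.

Lemma mW_one p : mW wone p = p.
Proof.
by apply: (@lin_eq (mW wone) (fun p => p)); [exact: lin_mW|exact: lin_id|move=> w; rewrite mWU wmul1w].
Qed.

Lemma mW_mD_sgen i xi p :
  mW (sgen i) (mD xi p) - mD (wact_t (sgen i) xi) (mW (sgen i) p) = - alpha_of i xi *: p.
Proof.
apply: (@lin_eq (fun p => mW (sgen i) (mD xi p) - mD (wact_t (sgen i) xi) (mW (sgen i) p)) (fun p => - alpha_of i xi *: p)).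
- apply: lin_subf; apply: lin_comp; try exact: lin_mW; exact: lin_mD.
- by apply: lin_scal; exact: lin_id.
move=> w; rewrite mWU !mDU.
have [pw|nw] := boolP (rpos (wr (winv w) (sroot i))); first exact: dunkl_sgen.
(* When s_i shortens w, the relation is the ascending case at s_i w, with xi replaced by s_i(xi) and
   multiplied by s_i. *)
have pw : rpos (wr (winv (wmul (sgen i) w)) (sroot i)).
  rewrite winvM winv_sgen // wrM wr_sroot // wr_opp rpos_opp // wr_isroot.
  exact: sroot_isroot.
have := congr1 (mW (sgen i)) (dunkl_sgen (wact_t (sgen i) xi) pw).
rewrite (linB (lin_mW _)) (linZ (lin_mW _)) -mW_mul sgenK // mW_one mWU wmulsK //.
rewrite -wact_tM sgenK // wact_t1 alpha_of_sgen opprK => h.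
by rewrite -opprB h scaleNr.
Qed.

Lemma mW_mD_pi xi p : mW piW (mD xi p) = mD (wact_t piW xi) (mW piW p).
Proof.
apply: (@lin_eq (fun p => mW piW (mD xi p)) (fun p => mD (wact_t piW xi) (mW piW p))); [apply: lin_comp; [exact: lin_mW|exact: lin_mD]|apply: lin_comp; [exact: lin_mD|exact: lin_mW]|].
move=> w; rewrite mWU !mDU mW_dunkl /dunkl wact_dualM ev_wact; congr (_ - _).
have pE : perm_eq (Slist (winv (wmul piW w))) (map (wr piW) (Slist (winv w))).
  apply: uniq_perm; rewrite ?map_inj_uniq ?Slist_uniq //; first exact: wr_inj.
  move=> r; rewrite -{2}(wrVK piW r) mem_map; last exact: wr_inj.
  by rewrite !mem_Slist winvM wrM wr_isroot rpos_piV.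
by rewrite (perm_big _ pE) /= big_map; apply: eq_bigr => r _; rewrite alr_wr.
Qed.

Lemma mD_hs i xi p : mD xi (mW (sgen i) p) =
  mW (sgen i) (mD (wact_t (sgen i) xi) p) - alpha_of i xi *: p.
Proof.
have := mW_mD_sgen i (wact_t (sgen i) xi) p.
rewrite -wact_tM sgenK // wact_t1 alpha_of_sgen opprK => <-.
by rewrite opprB addrC subrK.
Qed.

(** The formula does not show commutativity. It is proved on the basis by induction along W, from
    the identity element, where the operators are scalars, using only the cross relations already
    established. *)
Lemma mD_comm xi eta p : mD xi (mD eta p) = mD eta (mD xi p).
Proof.
apply: (@lin_eq (fun p => mD xi (mD eta p)) (fun p => mD eta (mD xi p))); try by apply: lin_comp; exact: lin_mD.
suff h w : okW true w -> forall xi eta, mD xi (mD eta (e w)) = mD eta (mD xi (e w)).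
  by move=> w; apply: h.
move: w; apply: (W_ind N2) => [xi' eta'|i w _ _ IH _ xi' eta'|_ w IH xi' eta'|_ w IH xi' eta'].
- have D1 (x : tvec F N) : mD x (e wone) = ev z x *: (e wone).
    by rewrite mDU /dunkl wact_dual1 winv1 rpos_nil ?big_nil ?subr0 // => r; rewrite wr1.
  by rewrite !D1 !(linZ (lin_mD _)) !D1 !scalerA mulrC.
- rewrite -mWU; set v := (e w).
  (* Two uses of the cross relation leave terms that are visibly symmetric in x and y, except the
     first, to which the induction hypothesis applies. *)
  have eq2 (x y : tvec F N) : mD x (mD y (mW (sgen i) v)) =
    mW (sgen i) (mD (wact_t (sgen i) x) (mD (wact_t (sgen i) y) v))
     + (alpha_of i x * alpha_of i y) *: mD (coroot i) v
     - (alpha_of i x *: mD y v + alpha_of i y *: mD x v).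
    rewrite mD_hs (linB (lin_mD _)) (linZ (lin_mD _)) mD_hs [in alpha_of i x *: _]mD_sgen.
    move: (mW _ _) (mD y v) (mD (coroot i) v) (mD x v) => A B C D.
    by rewrite scalerBr scalerA [in RHS]opprD [in RHS]addrA opprB addrA.
  by rewrite !eq2 IH mulrC [X in _ - X]addrC.
- by rewrite -mWU -(wact_tVK piW xi') -(wact_tVK piW eta') -!mW_mD_pi IH.
- suff : mW piW (mD xi' (mD eta' (e (wmul (winv piW) w)))) =
         mW piW (mD eta' (mD xi' (e (wmul (winv piW) w)))).
    by move=> /(congr1 (mW (winv piW))); rewrite -!mW_mul wmulVw !mW_one.
  by rewrite !mW_mD_pi mWU wmulVKw IH.
Qed.

Lemma mops_Hmod : is_Hmod mops.
Proof.
split.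
- split; [exact: lin_mW|split; [move=> i; exact: lin_mD|]].
  by apply: lin_scal; exact: lin_id.
- by split; [exact: mW_one|exact: mW_mul].
- split=> [i j v|i v] /=; first exact: mD_comm.
  exact: (linZ (lin_mD _)).
- by move=> i xi v; rewrite !actT_mops mW_mD_sgen.
- by move=> xi v; rewrite !actT_mops; exact: mW_mD_pi.
Qed.

End Model.

(** * The invariant vector of the Dunkl model *)

Section Blocks.
Variables (N : nat) (sel : 'I_N -> bool).
Implicit Types (a b c j : 'I_N) (u : 'S_N).
Local Notation sb := (sameblk sel).

Definition blockperm u := [forall j, sb j (u j)].

Lemma blockpermP u j : blockperm u -> sb j (u j).
Proof. by move/forallP/(_ j). Qed.

Lemma blockpermVP u j : blockperm u -> sb (u^-1 j)%g j.
Proof. by move/(blockpermP (u^-1 j)%g); rewrite permKV. Qed.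

Lemma blockperm_tperm u a b : sb a b -> blockperm u -> blockperm (u * tperm a b)%g.
Proof.
move=> ab /forallP h; apply/forallP => j; apply: (sameblk_trans (h j)); rewrite permM.
case: tpermP => [->|->|_ _]; rewrite ?sameblk_refl //; by rewrite sameblk_sym.
Qed.

Lemma blockperm_tpermE u a b : sb a b -> blockperm (u * tperm a b)%g = blockperm u.
Proof.
move=> ab; apply/idP/idP; last exact: blockperm_tperm.
by move/(blockperm_tperm ab); rewrite -mulgA tperm2 mulg1.
Qed.

(** Any index between a and b lies between a and u^{-1}(a) or between u^{-1}(b) and b, so the
    inversion stays in one block. *)
Lemma blockperm_inversion u a b : blockperm u -> (a < b)%N ->
  ((u^-1)%g b < (u^-1)%g a)%N -> sb a b.
Proof.
move=> wu ab inv; have /sameblkP h1 := blockpermVP a wu; have /sameblkP h2 := blockpermVP b wu.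
apply/sameblkP => j hj.
have [h|h] := leqP j ((u^-1)%g a); [apply: h1|apply: h2]; move: hj ab inv h; lia.
Qed.

End Blocks.

Section InvariantVector.
Variables (F : numClosedFieldType) (N : nat).
Hypothesis N2 : (2 <= N)%N.
Variables (sel : 'I_N -> bool) (z : tdual F N).
Hypothesis htd : in_tdual_gamma sel z.
Variables (U : lmodType F) (e : W N -> U) (lext : (W N -> U) -> U -> U).
Hypotheses (lin_lext : forall g, lin (lext g)) (lextU : forall g w, lext g (e w) = g w)
  (lin_eq : forall f g : U -> U, lin f -> lin g -> (forall w, f (e w) = g (e w)) ->
     forall p, f p = g p).
Implicit Types (a b c i j : 'I_N) (u : 'S_N).
Local Notation sb := (sameblk sel).

Definition above j : F := \sum_(b < N) ((j < b)%N && sb j b)%:R.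
Definition beneath j : F := \sum_(a < N) ((a < j)%N && sb a j)%:R.

(* [z] with each of its arithmetic progressions along a block reversed. *)
Definition zrev : tdual F N := ([ffun j => z.1 j + above j - beneath j], z.2).

Definition pvec u : U := e (u, [ffun => 0]).
Definition vec : U := \sum_(u | blockperm sel u) pvec u.

Lemma above_step i : val i != 0%N -> sel i -> above (prevo i) = above i + 1.
Proof.
move=> i0 si; rewrite /above (bigD1 i) //= [X in _ = X + 1](bigD1 i) //= ltnn add0r.
have -> : (i.-1 < i)%N by move: i0 => /=; lia.
have -> : sb (prevo i) i by case/and3P: (sroot_inR i0 si); rewrite /sroot (negPf i0).
rewrite addrC; congr (_ + 1); apply: eq_bigr => b bi; congr (_%:R); congr nat_of_bool.
have {}bi : (b != i :> nat) by rewrite val_eqE.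
have -> : (i.-1 < b)%N = (i < b)%N by move: i0 bi => /=; lia.
case ib: (i < b)%N => //=.
have pi : sb (prevo i) i by case/and3P: (sroot_inR i0 si); rewrite /sroot (negPf i0).
apply/idP/idP; last exact: sameblk_trans.
by apply: sameblk_trans; rewrite sameblk_sym.
Qed.

Lemma above_const a b : sb a b -> z.1 a + above a = z.1 b + above b.
Proof.
suff h (c d : 'I_N) : (c < d)%N -> sb c d -> z.1 c + above c = z.1 d + above d.
  move=> ab; case: (ltngtP a b) => [l|l|l]; first exact: h.
    by symmetry; apply: h; rewrite // sameblk_sym.
  by have -> : a = b by apply: val_inj.
apply: (sameblk_ind (R := fun c d => z.1 c + above c = z.1 d + above d)).
  by move=> i i0 si; rewrite above_step // (canRL (subrK _) (htd i0 si)); ring.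
by move=> p q r _ _ -> ->.
Qed.

Definition invpair u (q : 'I_N * 'I_N) := (q.1 < q.2)%N && ((u^-1)%g q.2 < (u^-1)%g q.1)%N.
Definition cc i (q : 'I_N * 'I_N) : F := (q.1 == i)%:R - (q.2 == i)%:R.

Lemma Slist_perm u : perm_eq (Slist (winv (u, [ffun => 0])))
  [seq (q.1, q.2, 0) | q <- enum [pred q | invpair u q]].
Proof.
apply: uniq_perm; first exact: Slist_uniq.
  by rewrite map_inj_uniq ?enum_uniq // => -[a b] [c d] /= [-> ->].
case=> [[a b] k]; rewrite mem_Slist /isroot /rpos /rootpos /wr /wroot /= !ffunE.
apply/idP/mapP => [|[[c d]]].
  rewrite !(oppr0, addr0) -val_eqE /= => h.
  have ne : (u^-1)%g a != (u^-1)%g b by rewrite (inj_eq perm_inj) -val_eqE; case/and3P: h.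
  have [k0 inv] : k = 0 /\ invpair u (a, b).
    rewrite /invpair /=; move: ne h; rewrite -val_eqE /=.
    move: (nat_of_ord ((u^-1)%g a)) (nat_of_ord ((u^-1)%g b)) (nat_of_ord a) (nat_of_ord b).
    by move=> ????; lia.
  by exists (a, b); rewrite ?mem_enum ?k0.
rewrite mem_enum inE /invpair /= => h [-> -> ->]; rewrite !(oppr0, addr0) -val_eqE /=.
by move: (nat_of_ord ((u^-1)%g c)) (nat_of_ord ((u^-1)%g d)) (nat_of_ord c) (nat_of_ord d) h => ????; lia.
Qed.

Lemma dunkl_pvec i u : dunkl zrev e (tbasis F i) (u, [ffun => 0]) =
  zrev.1 ((u^-1)%g i) *: pvec u - \sum_(q | invpair u q) cc i q *: pvec (u * tperm q.1 q.2)%g.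
Proof.
rewrite /dunkl ev_tbasis; congr (_ *: _ - _).
  by rewrite ffunE [X in _ * X%:~R]ffunE mulr0 addr0.
rewrite (perm_big _ (Slist_perm u)) /= big_map big_enum /=; apply: eq_bigr => q _.
congr (_ *: e _); first by rewrite /alr /cc !ffunE.
by apply: W_eqP => [|j] //=; rewrite !ffunE oppr0 mul0r addr0.
Qed.

Lemma invpair_tperm u (q : 'I_N * 'I_N) :
  blockperm sel (u * tperm q.1 q.2)%g && invpair (u * tperm q.1 q.2)%g q =
  blockperm sel u && [&& (q.1 < q.2)%N, sb q.1 q.2 & ((u^-1)%g q.1 < (u^-1)%g q.2)%N].
Proof.
have e1 : ((u * tperm q.1 q.2)^-1)%g q.1 = (u^-1)%g q.2 by rewrite invMg tpermV permM tpermL.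
have e2 : ((u * tperm q.1 q.2)^-1)%g q.2 = (u^-1)%g q.1 by rewrite invMg tpermV permM tpermR.
have [qq|nq] := boolP (sb q.1 q.2); first by rewrite blockperm_tpermE // /invpair e1 e2.
rewrite andbF andbF; apply/negbTE; apply: contra nq => /andP[wu /andP[h1 h2]].
exact: blockperm_inversion wu h1 h2.
Qed.

(** The left side counts the block indices above i that keep their order with i under u^{-1}, minus
    those below i that do. The block indices above i that are inverted with i enter both [above i]
    and [beneath] of u^{-1}(i), and cancel on the right. *)
Lemma cc_count i u : blockperm sel u ->
  \sum_(q : 'I_N * 'I_N | [&& (q.1 < q.2)%N, sb q.1 q.2 & ((u^-1)%g q.1 < (u^-1)%g q.2)%N]) cc i q
  = above i - beneath ((u^-1)%g i).
Proof.
move=> wu; pose C a b := [&& (a < b)%N, sb a b & ((u^-1)%g a < (u^-1)%g b)%N].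
rewrite big_mkcond /= -(pair_bigA _ (fun a b => if C a b then cc i (a, b) else 0)) /=.
have -> : \sum_a \sum_b (if C a b then cc i (a, b) else 0) = \sum_b (C i b)%:R - \sum_a (C a i)%:R.
  rewrite -(sum_delta i (fun a => \sum_b (C a b)%:R)).
  rewrite -[X in _ - X](_ : \sum_a \sum_b (b == i)%:R * (C a b)%:R = _); last first.
    by apply: eq_bigr => a _; rewrite sum_delta.
  rewrite -sumrB; apply: eq_bigr => a _; rewrite mulr_sumr -sumrB; apply: eq_bigr => b _.
  by rewrite /cc -mulrBl; case: (C a b); rewrite ?mulr1 ?mulr0.
rewrite /above /beneath [X in _ = _ - X](reindex_inj (@perm_inj _ (u^-1)%g)) /= -!sumrB.
apply: eq_bigr => a _.
have -> : sb ((u^-1)%g a) ((u^-1)%g i) = sb i a.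
  apply/idP/idP => h.
    apply: (sameblk_trans (b := (u^-1)%g i)); first by rewrite sameblk_sym blockpermVP.
    by apply: (sameblk_trans (b := (u^-1)%g a)); rewrite 1?sameblk_sym // sameblk_sym blockpermVP.
  apply: (sameblk_trans (b := a)); first exact: blockpermVP.
  by apply: (sameblk_trans (b := i)); rewrite sameblk_sym // blockpermVP.
rewrite /C [sb a i]sameblk_sym; case: (sb i a); rewrite ?andbF //= ?andbT.
have ne : (a == i) = ((u^-1)%g a == (u^-1)%g i) by rewrite (inj_eq perm_inj).
move: ne; rewrite -!val_eqE /=.
move: (nat_of_ord a) (nat_of_ord i) (nat_of_ord ((u^-1)%g a)) (nat_of_ord ((u^-1)%g i)).
move=> p q r s; case: (ltngtP p q); case: (ltngtP r s) => //=; rewrite ?subrr ?subr0 ?sub0r //.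
Qed.

Local Notation Mod := (mops zrev e lext).

(** Reindexing by the reflection collects the coefficient of each u: the value of [zrev] at
    u^{-1}(i), minus [above i], plus [beneath] of u^{-1}(i). The reversal of the progressions is
    chosen so that this equals z_i for every u, because z + [above] is constant on blocks. *)
Lemma vec_X i : mD zrev e lext (tbasis F i) vec = z.1 i *: vec.
Proof.
rewrite /vec (lin_sum (lin_mD zrev e lin_lext _)) scaler_sumr.
under eq_bigr do rewrite /pvec (mDU zrev lextU) dunkl_pvec.
rewrite sumrB.
rewrite (exchange_big_dep xpredT) //=.
have -> : \sum_(q : 'I_N * 'I_N) \sum_(u | blockperm sel u && invpair u q)
     cc i q *: pvec (u * tperm q.1 q.2)%g =
   \sum_(u | blockperm sel u) (above i - beneath ((u^-1)%g i)) *: pvec u.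
  transitivity (\sum_(q : 'I_N * 'I_N) \sum_(u | blockperm sel u &&
      [&& (q.1 < q.2)%N, sb q.1 q.2 & ((u^-1)%g q.1 < (u^-1)%g q.2)%N]) cc i q *: pvec u).
    apply: eq_bigr => q _; rewrite (reindex_inj (mulIg (tperm q.1 q.2))) /=.
    apply: eq_big => [u|u _]; first exact: invpair_tperm.
    by rewrite -mulgA tperm2 mulg1.
  rewrite (exchange_big_dep (fun u => blockperm sel u)) /=; last by move=> ? ? _ /andP[].
  by apply: eq_bigr => u wu; rewrite -cc_count // scaler_suml; apply: eq_bigl => q; rewrite wu.
rewrite -sumrB; apply: eq_bigr => u wu; rewrite -scalerBl; congr (_ *: _).
rewrite ffunE; have := above_const (blockpermVP i wu); set p := (u^-1)%g i => h.
by rewrite h; ring.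
Qed.

Lemma vec_rel : relH sel z Mod vec.
Proof.
split=> [w|i|] //; last exact: vec_X.
move=> [js [sjs ->]]; elim: js sjs => [|i js IH] /=; first by rewrite (mW_one lin_lext lextU lin_eq).
move=> /andP[/andP[i0 si] /IH /= h]; rewrite (mW_mul lin_lext lextU lin_eq) h.
have pi : sb (prevo i) i by case/and3P: (sroot_inR i0 si); rewrite /sroot (negPf i0).
rewrite /vec (lin_sum (lin_mW e lin_lext _)) [RHS](reindex_inj (mulIg (tperm (prevo i) i))) /=.
apply: eq_big => [u|u _]; first by rewrite blockperm_tpermE.
rewrite /pvec (mWU lextU); congr e; rewrite /sgen (negPf i0).
by apply: W_eqP => [|j] //=; rewrite !ffunE addr0.
Qed.

Lemma vec_neq0 (f : U -> F^o) : lin f -> (forall w, f (e w) = (w == wone)%:R) -> vec <> 0.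
Proof.
move=> lf fe /(congr1 f); rewrite (lin0 lf) /vec (lin_sum lf) (bigD1 1%g) /=; last first.
  by apply/forallP => j; rewrite perm1 sameblk_refl.
rewrite fe eqxx big1 ?addr0 => [/eqP|u /andP[_ /negPf u1]]; first by rewrite oner_eq0.
by rewrite fe xpair_eqE u1.
Qed.

End InvariantVector.

Lemma relH_model (F : numClosedFieldType) (N : nat) (sel : 'I_N -> bool) (z : tdual F N) :
  (2 <= N)%N -> in_tdual_gamma sel z ->
  exists (U : lmodType F) (M : Hops F N U) (u : U), [/\ is_Hmod M, relH sel z M u & u <> 0].
Proof.
move=> N2 htd; pose U : lmodType F := {malg F[W N]}.
pose e : W N -> U := fun w => << w >>.
pose lx : (W N -> U) -> U -> U := fun g => lext g.
have l1 g : lin (lx g) by exact: lin_lext.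
have l2 g w : lx g (e w) = g w by exact: lextU.
have l3 (f g : U -> U) : lin f -> lin g -> (forall w, f (e w) = g (e w)) -> forall p, f p = g p.
  exact: lin_eq.
exists U, (mops (zrev sel z) e lx), (vec sel e); split.
- exact: mops_Hmod.
- exact: vec_rel.
apply: (@vec_neq0 _ _ _ _ _ (lext (fun w => (w == wone)%:R : F^o))); first exact: lin_lext.
by move=> w; exact: lextU.
Qed.

(** * The decomposition *)

Section FiniteRestriction.
Variables (F : numClosedFieldType) (N : nat).
Hypothesis N2 : (2 <= N)%N.
Implicit Types (u : 'S_N) (w : W N) (i : 'I_N).

Lemma sgen_fin i : val i != 0%N -> sgen i = (tperm (prevo i) i, [ffun => 0]).
Proof. by rewrite /sgen => /negPf ->. Qed.

Lemma wmul_fin u u' : wmul (u, [ffun => 0]) (u', [ffun => 0]) = ((u' * u)%g, [ffun => 0]) :> W N.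
Proof. by apply: W_eqP => // j; rewrite !ffunE addr0. Qed.

Lemma okW_fin w : okW false w -> w = (w.1, [ffun => 0]).
Proof. by case: w => u eta /= /eqP /= ->. Qed.

Lemma in_Wbar_gamma_fin (sel : 'I_N -> bool) w : in_Wbar_gamma sel w -> w.2 = [ffun => 0].
Proof.
move=> [js [sjs ->]]; apply/eqP; elim: js sjs => [|i js IH] //= /andP[/andP[i0 _] /IH h].
by apply: (@okWM N false (sgen i)) => //; apply: okW_sgen; rewrite /okS i0.
Qed.

Lemma is_Hmod_pmod full (V : lmodType F) (M : Hops F N V) : is_Hmod M -> is_pmod full M.
Proof. by move=> [h1 h2 h3 h4 h5]; split. Qed.

Lemma wact_t_fin i (xi : tvec F N) : val i != 0%N ->
  wact_t (sgen i) xi = ([ffun j => xi.1 ((tperm (prevo i) i)^-1%g j)], xi.2).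
Proof.
move=> i0; rewrite sgen_fin // /wact_t /=; congr pair.
by rewrite big1 ?subr0 // => j _; rewrite ffunE mul0r.
Qed.

Lemma alpha_of_fin i (xi : tvec F N) : val i != 0%N -> alpha_of i xi = xi.1 (prevo i) - xi.1 i.
Proof. by rewrite /alpha_of => /negPf ->. Qed.

Lemma resB_Bmod (V : lmodType F) (M : Hops F N V) : is_Hmod M -> is_Bmod (resB M).
Proof.
move=> [[lW [lX lC]] [h1 hm] [hxx hxc] hs _].
have aE xi v : actTb (resB M) xi v = actT M (xi, 0) v by rewrite /actT scale0r addr0.
split=> //=; first by split=> [v|u u' v]; [exact: h1|rewrite -hm wmul_fin].
move=> i xi v i0; have := hs i (xi, 0) v.
by rewrite wact_t_fin // alpha_of_fin // sgen_fin // !aE.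
Qed.

(** W acts through its projection to \bar W. When [full] is false, translations are constrained by
    the group law alone, which the projection respects. *)
Definition liftB (V : lmodType F) (c : F) (B : Bops F N V) : Hops F N V :=
  HOps (fun w => bW B w.1) (bX B) (fun v => c *: v).

Lemma liftB_pmod (V : lmodType F) (c : F) (B : Bops F N V) : is_Bmod B -> is_pmod false (liftB c B).
Proof.
move=> [[lW lX] [h1 hm] hxx hs].
split; last by [].
- by split; [move=> w; exact: lW|split; [exact: lX|apply: lin_scal]].
- by split=> [|x y v] /=; [exact: h1|rewrite hm].
- by split=> // i v /=; rewrite (linZ (lX i)).
move=> i xi v; rewrite /okS /= => i0; have aE xi' v' : actT (liftB c B) xi' v' =
    actTb B xi'.1 v' + xi'.2 *: (c *: v') by [].
rewrite !aE wact_t_fin // alpha_of_fin // sgen_fin //= -(hs i xi.1 v i0).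
by rewrite (linD (lW _)) !(linZ (lW _)) opprD addrACA subrr addr0.
Qed.

End FiniteRestriction.

(** * The summands, their irreducibility and their direct sum *)

Section Decomposition.
Variables (F : numClosedFieldType) (N : nat) (beta : seq nat) (z : tdual F N).
Hypotheses (N2 : (2 <= N)%N) (htd : in_tdual_gamma (selP beta) z)
  (hgen : pgeneric true (selP beta) z) (hc : true -> z.2 != 0).
Variables (V : lmodType F) (M : Hops F N V) (one : V).
Hypotheses (hM : is_Hmod M) (hrel : relH (selP beta) z M one) (one0 : one <> 0).
Implicit Types (x w : W N) (v y : V) (i : 'I_N).
Local Notation sel := (@selP N beta).
Local Notation Rt := (Reach true z M one).

Let hMt : is_pmod true M := is_Hmod_pmod true hM.
Let hMf : is_pmod false M := is_Hmod_pmod false hM.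

Lemma Reach_word (js : seq 'I_N) :
  {in word_roots js, forall r, isroot r && rpos r && ~~ inR sel r} ->
  Rt (wword js) (foldr (phi_gen M) one js).
Proof.
elim: js => [|i js IH] h /=; first exact: Reach_one.
have := h (wr (winv (wword js)) (sroot i)); rewrite inE eqxx => /(_ isT)/andP[/andP[ir pr] nr].
have [n1 _ nm] := hgen isT ir pr nr; rewrite -pz_wactV in n1 nm.
by apply: Reach_phi => //; apply: IH => r rj; apply: h; rewrite inE rj orbT.
Qed.

Lemma Reach_pow w v k : Rt w v -> Rt (wmul (wpowz piW k) w) (hW M (wpowz piW k) v).
Proof.
move=> R; case: k => n; rewrite /wpowz.
  elim: n => [|n IH] /=; first by rewrite wmul1w (hW1 hMt).
  by rewrite -wmulA (hWM hMt); apply: Reach_pi.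
elim: n.+1 => [|m IH] /=; first by rewrite wmul1w (hW1 hMt).
by rewrite -wmulA (hWM hMt); apply: Reach_piV.
Qed.

(** Along a reduced word each pairing equals (zeta, r) for some r in S(x). As x is minimal, r is not
    a block root, and genericity excludes 1 and -1. *)
Lemma Reach_red x rd : minrep sel x -> is_red x rd -> Rt x (phi_red M rd one).
Proof.
move=> mx xr; have [xE _] := xr; rewrite {1}xE; apply: Reach_pow; apply: Reach_word => r rr.
have := is_red_roots N2 xr rr; rewrite mem_Slist => /and3P[-> -> nr] /=.
by apply: contra nr; apply: minrepP.
Qed.

(** For a simple root of beta(x) the pairing is -1, so phi_i y = y - s_i y, which vanishes by
    resonance. *)
Lemma fiber_sgen x y i : xcond beta x -> Rt x y -> selB sel x i -> hW M (sgen i) y = y.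
Proof.
move=> xc R si; have i0 : val i != 0%N by case/andP: si.
have [p [p0 sp wp]] := selB_simple N2 xc si.
have sE : sroot i = (prevo i, i, 0) by rewrite /sroot (negPf i0).
have m1 : pz (wact_dual x z) (sroot i) = -1.
  rewrite sE -wp pz_wact -(htd p0 sp) /sroot (negPf p0) /pz /pair_root /=; ring.
have [_ wy _ _] := ReachP N2 htd hgen hc hMt hrel R.
have := Reach_phi0 N2 htd hgen hc hMt hrel (i := i) isT R; rewrite m1 eqxx orbT => /(_ isT).
rewrite (phi_wt hMt i wy) m1 scaleN1r => /eqP.
by rewrite subr_eq0 => /eqP.
Qed.

Lemma fiber_rel x y : xcond beta x -> Rt x y -> relH (selB sel x) (wact_dual x z) M y.
Proof.
move=> xc R; have [_ [wX wC] _ _] := ReachP N2 htd hgen hc hMt hrel R; split=> // w [js [sjs ->]].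
elim: js sjs => [|i js IH] /=; first by rewrite (hW1 hMt).
by move=> /andP[/andP[_ si] /IH h]; rewrite (hWM hMt) h (fiber_sgen xc R si).
Qed.

Section Fiber.
Variables (x : W N) (y : V).
Hypotheses (xc : xcond beta x) (R : Rt x y).
Local Notation hs := (hspan false M y).

Let xtd := xcond_tdual N2 htd xc.
Let xgen := xcond_pgeneric N2 htd hgen xc.
Let xc0 : false -> (wact_dual x z).2 != 0. Proof. by []. Qed.
Let xrel := fiber_rel xc R.

Lemma BgenP v : Bgen (resB M) y v <-> hs v.
Proof.
split=> [|h].
- elim=> {v} [||u w _ hu _ hw|a u _ hu|s u _ hu|i u _ hu].
  + exact (hspan_one hMf).
  + by case: (hspan_sub false M y).
  + by case: (hspan_sub false M y) => _ + _; apply.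
  + by case: (hspan_sub false M y) => _ _; apply.
  + by apply: (hspan_W hMf) => //; rewrite /okW eqxx.
  + exact: (hspan_X N2 hMf xrel).
- apply: (h (Bgen (resB M) y)); first by split; [exact: Bg_zero|exact: Bg_add|exact: Bg_scale].
  move=> u [w /okW_fin -> ->]; exact: (Bg_W (B := resB M)) (Bg_base _ _).
Qed.

Lemma Bsub_stable Q : is_Bsub (resB M) Q -> stable false M Q.
Proof.
move=> [Q0 QD QZ QW QX]; split=> // i v; rewrite /okS /= => i0 Qv.
by rewrite sgen_fin //; apply: QW.
Qed.

Lemma Bgen_Bsub : is_Bsub (resB M) (Bgen (resB M) y).
Proof. by split; constructor. Qed.

Lemma fiber_neq0 : y <> 0.
Proof. exact: (Reach_neq0 N2 htd hgen hc hMt hrel one0 R). Qed.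

(** This is [stable_one] for \bar W, with y as cyclic vector, x(zeta) as weight and beta(x) as
    partition. *)
Lemma fiber_irr Q q : is_Bsub (resB M) Q -> (forall v, Q v -> Bgen (resB M) y v) ->
  Q q -> q <> 0 -> forall v, Bgen (resB M) y v -> Q v.
Proof.
move=> sQ QM Qq q0.
have Qy : Q y.
  apply: (stable_one N2 xtd xgen xc0 hMf xrel (Bsub_stable sQ) _ Qq q0).
  exact/BgenP/QM.
case: sQ => Q0 QD QZ QW QX v; elim=> //.
- by move=> *; apply: QD.
- by move=> *; apply: QZ.
- by move=> *; apply: QW.
- by move=> *; apply: QX.
Qed.

Lemma fiber_Birreducible : Birreducible (resB M) (Bgen (resB M) y).
Proof.
split; first by exists y; split; [exact: Bg_base|exact: fiber_neq0].
move=> Q sQ QM; have [[q [Qq q0]]|h] := classic (exists q, Q q /\ q <> 0).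
  by right; apply: (fiber_irr sQ QM Qq q0).
by left=> v Qv; apply: NNPP => v0; apply: h; exists v.
Qed.

(** The map comes from the universal property. For injectivity the cyclic-module argument is run on
    the source: a nonzero kernel would contain the generator, whose image y is nonzero. *)
Lemma fiber_iso (Vb : lmodType F) (Bb : Bops F N Vb) (oneb : Vb) :
  is_induced_B (selB sel x) (wact_dual x z).1 Bb oneb ->
  exists f : Vb -> V, [/\ lin f, equivB Bb (resB M) f, f oneb = y, injective f
    & forall v, Bgen (resB M) y v <-> exists q, f q = v].
Proof.
move=> [hB hrb hgb univ].
have [|f [lf [fW fX] f1]] := univ V (resB M) y (resB_Bmod hM).
  by case: xrel => h1 h2 _; split=> // u hu; apply: h1.
(* Letting c act by x(zeta)(c) makes the source a partial module with a cyclic vector of weight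
   x(zeta). *)
pose M3 := liftB (wact_dual x z).2 Bb.
have hM3 : is_pmod false M3 := liftB_pmod _ hB.
have rel3 : relH (selB sel x) (wact_dual x z) M3 oneb.
  case: hrb => h1 h2; split=> // w hw; apply: h1.
  by case: w hw => u eta hw; rewrite -(in_Wbar_gamma_fin hw).
have hs3 (q : Vb) : hspan false M3 oneb q.
  elim: {q}(hgb q) => [||u w _ hu _ hw|a u _ hu|s u _ hu|i u _ hu].
  + exact (hspan_one hM3).
  + by case: (hspan_sub false M3 oneb).
  + by case: (hspan_sub false M3 oneb) => _ + _; apply.
  + by case: (hspan_sub false M3 oneb) => _ _; apply.
  + by apply: (hspan_W hM3 (w := (s, [ffun => 0]))) => //; rewrite /okW eqxx.
  + exact: (hspan_X N2 hM3 rel3).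
exists f; split=> //.
- move=> a b fab; apply/eqP; rewrite -subr_eq0; apply/eqP; apply: NNPP => ab0.
  apply: fiber_neq0; rewrite -f1.
  apply: (stable_one N2 xtd xgen xc0 hM3 rel3 (Q := fun q => f q = 0) _ (hs3 _) _ ab0); last first.
    by rewrite (linB lf) fab subrr.
  split=> //; first by split=> [|u v e e'|c u e]; rewrite ?(lin0 lf) ?(linD lf) ?(linZ lf) ?e ?e' ?addr0 ?scaler0.
    by move=> i q e; rewrite /= fX e; exact: (lin0 (lX hMf i)).
  by move=> i q _ e; rewrite /= fW e; exact: (lin0 (lW hMf _)).
- move=> v; split.
    elim=> {v} [||u w _ [u' <-] _ [w' <-]|a u _ [u' <-]|s u _ [u' <-]|i u _ [u' <-]].
    + by exists oneb.
    + by exists 0; rewrite (lin0 lf).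
    + by exists (u' + w'); rewrite (linD lf).
    + by exists (a *: u'); rewrite (linZ lf).
    + by exists (bW Bb s u'); rewrite fW.
    + by exists (bX Bb i u'); rewrite fX.
  move=> [w <-]; elim: (hgb w) => [||u w' _ hu _ hw|a u _ hu|s u _ hu|i u _ hu].
  + by rewrite f1; exact: Bg_base.
  + by rewrite (lin0 lf); exact: Bg_zero.
  + by rewrite (linD lf); exact: Bg_add.
  + by rewrite (linZ lf); exact: Bg_scale.
  + by rewrite fW; exact: Bg_W.
  + by rewrite fX; exact: Bg_X.
Qed.

(** The weights of this summand are the w x(zeta) with w in \bar W. None of them is x'(zeta) on \bar
    t, since X^beta meets a \bar W-orbit at most once. *)
Lemma fiber_weights x' v : xcond beta x' -> x' <> x -> hs v ->
  carried M (wact_dual x' z).1 (fun u => u = 0) v.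
Proof.
move=> xc' xx' hv; have s0 : subsp (fun u : V => u = 0) by case: (zero_stable hMf).
have sE := carried_subsp hMf (wact_dual x' z).1 s0 (fun i u e => etrans (congr1 (hX M i) e) (lin0 (lX hMf i))).
have := hspan_Reach N2 xtd xgen xc0 hMf xrel hv; apply=> // u [w Rw].
have [ow [wX _] _ _] := ReachP N2 xtd xgen xc0 hMf xrel Rw.
have /existsP[i hi] : [exists i, (wact_dual x' z).1 i != (wact_dual w (wact_dual x z)).1 i].
  apply/existsPn => h; apply: xx'.
  have e : x' = wmul w x.
    apply: (wact_inj htd hgen hc) => //; rewrite wact_dualM; apply/ffunP => i.
    by apply/eqP; rewrite -[_ == _]negbK; exact: h.
  by apply: (xcond_uniq N2 xc' xc (s := w.1)); rewrite -(okW_fin ow).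
by apply: (carried_step hi); apply: carried_base; rewrite wX subrr.
Qed.

End Fiber.

(** Finite ascents through invertible intertwiners can only stop at an element of X^beta, where the
    vector is proportional to phi1 by [Reach_line]. Applying the same intertwiners again leads back
    to v inside the \bar H-submodule. *)
Lemma sort_fiber (phi1 : W N -> V) :
  (forall x, xcond beta x -> Rt x (phi1 x)) ->
  forall w v, Rt w v -> exists2 x, xcond beta x & Bgen (resB M) (phi1 x) v.
Proof.
move=> hphi w0 v0 R0.
(* The \bar W-orbit is finite, so lengths on it are bounded and the climb ends; the induction is on
   the gap to K. *)
pose K := \max_(s : 'S_N) wlength (wmul (s, [ffun => 0%R]) w0).
suff h n (s : 'S_N) v : (K <= wlength (wmul (s, [ffun => 0%R]) w0) + n)%N ->
    Rt (wmul (s, [ffun => 0]) w0) v -> exists2 x, xcond beta x & Bgen (resB M) (phi1 x) v.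
  by apply: (h K 1%g); rewrite ?leq_addl // [wmul _ _]wmul1w.
elim: n s v => [|n IH] s v; set w := wmul _ w0 => hK R;
  have [ow wv mw hv] := ReachP N2 htd hgen hc hMt hrel R.
all: have [xc|[i [i0 pr nr]]] := xcond_or_ascent N2 mw;
  first by exists w => //; have [c ->] := Reach_line N2 htd hgen hc hMt hrel (hphi w xc) hv wv;
     exact: Bg_scale (Bg_base _ _).
all: have lt := wlength_sgen_gt N2 pr.
all: have sw : wmul (sgen i) w = wmul ((s * tperm (prevo i) i)%g, [ffun => 0]) w0
  by rewrite /w wmulA sgen_fin // wmul_fin.
  have := @leq_bigmax _ (fun s : 'S_N => wlength (wmul (s, [ffun => 0]) w0)) (s * tperm (prevo i) i)%g.
  by rewrite -sw -/K => h; move: hK lt h; lia.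
have ir : isroot (wr (winv w) (sroot i)) by rewrite wr_isroot sroot_isroot.
have [n1 _ nm] := hgen isT ir pr nr; rewrite -pz_wactV in n1 nm.
have R' : Rt (wmul (sgen i) w) (phi_gen M i v) by exact: Reach_phi.
have [x xc Bx] : exists2 x, xcond beta x & Bgen (resB M) (phi1 x) (phi_gen M i v).
  by apply: (IH (s * tperm (prevo i) i)%g); rewrite -sw //; move: hK lt; lia.
exists x => //; apply: (subspZ (a := 1 - pz (wact_dual w z) (sroot i) ^+ 2)).
- by split; [exact: Bg_zero|exact: Bg_add|exact: Bg_scale].
- exact: one_sqr_neq0.
rewrite -(phi_phi N2 hMt (i := i) isT wv).
have oi : okS false i by rewrite /okS i0.
apply: (stable_phi hMf (Bsub_stable (Bgen_Bsub _)) oi _ Bx).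
by rewrite -/w; apply: (wt_phi N2 hMt (i := i) isT wv).
Qed.

Lemma fiber_sum (phi1 : W N -> V) :
  (forall x, xcond beta x -> Rt x (phi1 x)) -> forall v, hspan true M one v ->
  exists (s : seq (W N)) (m : W N -> V), [/\ uniq s, forall x, x \in s -> xcond beta x,
    forall x, x \in s -> Bgen (resB M) (phi1 x) (m x) & v = \sum_(x <- s) m x].
Proof.
move=> hphi v hv; pose P v := exists (s : seq (W N)) (m : W N -> V), [/\ uniq s, forall x, x \in s -> xcond beta x,
    forall x, x \in s -> Bgen (resB M) (phi1 x) (m x) & v = \sum_(x <- s) m x].
rewrite -/(P v); have := hspan_Reach N2 htd hgen hc hMt hrel hv; apply=> {v hv} [|v [w R]]; last first.
  have [x xc Bx] := sort_fiber hphi R.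
  exists [:: x], (fun=> v); split=> // [x'|x'|]; rewrite ?big_seq1 // inE => /eqP -> //.
split=> [|u v [s1 [m1 [u1 X1 B1 ->]]] [s2 [m2 [u2 X2 B2 ->]]]|a v [s [m [us Xs Bs ->]]]].
- by exists [::], (fun=> 0); split=> //; rewrite big_nil.
(* Components are extended by zero so that two sums over different supports can be added over their
   union. *)
- pose r (s : seq (W N)) (m : W N -> V) x := if x \in s then m x else 0.
  have rB s m x : (forall x, x \in s -> Bgen (resB M) (phi1 x) (m x)) -> Bgen (resB M) (phi1 x) (r s m x).
    by move=> h; rewrite /r; case: ifP => [/h //|_]; exact: Bg_zero.
  pose t := undup (s1 ++ s2).
  have rS s m : uniq s -> {subset s <= t} -> \sum_(x <- s) m x = \sum_(x <- t) r s m x.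
    move=> us st; rewrite -big_mkcond -[RHS]big_filter; apply: perm_big.
    apply: uniq_perm => //; first exact: filter_uniq (undup_uniq _).
    by move=> x; rewrite mem_filter; case xs: (x \in s) => //=; rewrite st.
  exists t, (fun x => r s1 m1 x + r s2 m2 x); split.
  + exact: undup_uniq.
  + by move=> x; rewrite mem_undup mem_cat => /orP[/X1|/X2].
  + by move=> x _; apply: Bg_add; apply: rB.
  + rewrite big_split /=; congr +%R; apply: rS => // x xs; by rewrite mem_undup mem_cat xs ?orbT.
- exists s, (fun x => a *: m x); split=> // [x /Bs h|]; first exact: Bg_scale.
  by rewrite scaler_sumr.
Qed.

(** If m x were nonzero, the intersection Q of the summand of x with the sum of the others would
    contain phi1 x by irreducibility. But x(zeta) is not a weight of the others, so phi1 x would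
    vanish. *)
Lemma fiber_independent (phi1 : W N -> V) (s : seq (W N)) (m : W N -> V) :
  (forall x, xcond beta x -> Rt x (phi1 x)) ->
  uniq s -> (forall x, x \in s -> xcond beta x) ->
  (forall x, x \in s -> Bgen (resB M) (phi1 x) (m x)) ->
  \sum_(x <- s) m x = 0 -> forall x, x \in s -> m x = 0.
Proof.
move=> hphi us Xs Bs s0 x xs; apply: NNPP => mx0.
have xc := Xs x xs; have R := hphi x xc.
pose Q v := Bgen (resB M) (phi1 x) v /\ exists2 m' : W N -> V,
  forall x', x' \in s -> x' != x -> Bgen (resB M) (phi1 x') (m' x')
  & v = \sum_(x' <- s | x' != x) m' x'.
have QB : is_Bsub (resB M) Q.
  split.
  - split; first exact: Bg_zero.
    by exists (fun=> 0); [move=> x' _ _; exact: Bg_zero|rewrite big1].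
  - move=> u v [Bu [mu hu eu]] [Bv [mv hv ev]]; split; first exact: Bg_add.
    exists (fun x' => mu x' + mv x'); last by rewrite eu ev big_split.
    by move=> x' xs' ne; apply: Bg_add; [apply: hu|apply: hv].
  - move=> a u [Bu [mu hu eu]]; split; first exact: Bg_scale.
    by exists (fun x' => a *: mu x'); [move=> x' xs' ne; apply/Bg_scale/hu|rewrite eu scaler_sumr].
  - move=> g u [Bu [mu hu e]]; split; first exact: Bg_W.
    exists (fun x' => bW (resB M) g (mu x')); first by move=> x' xs' ne; apply/Bg_W/hu.
    by rewrite e; exact: (lin_sum (lW hMt _)).
  - move=> i u [Bu [mu hu e]]; split; first exact: Bg_X.
    exists (fun x' => bX (resB M) i (mu x')); first by move=> x' xs' ne; apply/Bg_X/hu.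
    by rewrite e; exact: (lin_sum (lX hMt _)).
have Qm : Q (m x).
  split; first exact: Bs.
  exists (fun x' => - m x').
    by move=> x' xs' _; rewrite -scaleN1r; apply/Bg_scale/Bs.
  by apply/eqP; rewrite sumrN -addr_eq0 -(bigD1_seq x) //= s0.
have [_ [m' hm' yE]] : Q (phi1 x).
  by apply: (fiber_irr xc R QB _ Qm mx0); [move=> v []|exact: Bg_base].
have s0' : subsp (fun u : V => u = 0) by case: (zero_stable hMt).
have DX i (u : V) : u = 0 -> hX M i u = 0 by move=> ->; exact: (lin0 (lX hMt i)).
have : carried M (wact_dual x z).1 (fun u => u = 0) (phi1 x).
  rewrite yE -big_filter; apply: subsp_sum; first exact: (carried_subsp hMt _ s0' DX).
  move=> x'; rewrite mem_filter => /andP[ne xs'].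
  have R' := hphi x' (Xs x' xs').
  apply: (fiber_weights (Xs x' xs') R' xc); first by apply/eqP; rewrite eq_sym.
  by apply/(BgenP (Xs x' xs') R'); apply: hm'.
have [_ wy _ _] := ReachP N2 htd hgen hc hMt hrel R.
by move=> /(carried_wt hMt s0' (erefl _) wy); exact: (fiber_neq0 R).
Qed.

End Decomposition.

Theorem theorem2p23 (F : numClosedFieldType) (N : nat) (hN : (2 <= N)%N)
  (beta : seq nat) (hbeta : is_composition N beta)
  (zeta : tdual F N)
  (hzeta : in_tdual_gamma (selP beta) zeta)
  (hgen : generic (selP beta) zeta)
  (hc : zeta.2 != 0)
  (V : lmodType F) (M : Hops F N V) (one : V)
  (hY : is_induced_H (selP beta) zeta M one)
  (red : W N -> int * seq 'I_N)
  (hred : forall x, in_X (selP beta) x -> is_red x (red x)) :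
  let B := resB M in
  let phi1 := fun x => phi_red M (red x) one in
  let Mx := fun x => Bgen B (phi1 x) in
  (* Y_beta(zeta) = direct sum of the Hbar . phi_x 1_zeta, x in X^beta *)
  (forall v : V, exists (s : seq (W N)) (m : W N -> V),
      [/\ forall x, x \in s -> in_X (selP beta) x,
          forall x, x \in s -> Mx x (m x)
        & v = \sum_(x <- s) m x]) /\
  (forall (s : seq (W N)) (m : W N -> V),
      uniq s -> (forall x, x \in s -> in_X (selP beta) x) ->
      (forall x, x \in s -> Mx x (m x)) ->
      \sum_(x <- s) m x = 0 -> forall x, x \in s -> m x = 0) /\
  (* each summand is irreducible *)
  (forall x, in_X (selP beta) x -> Birreducible B (Mx x)) /\
  (* and isomorphic to \bar Y_{beta(x)}(\bar{x(zeta)}) via 1 |-> phi_x 1_zeta *)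
  (forall x, in_X (selP beta) x ->
     forall (Vb : lmodType F) (Bb : Bops F N Vb) (oneb : Vb),
       is_induced_B (selB (selP beta) x) (wact_dual x zeta).1 Bb oneb ->
       exists f : Vb -> V,
         [/\ lin f, equivB Bb B f, f oneb = phi1 x, injective f
           & forall v, Mx x v <-> exists w, f w = v]).
Proof.
have [hM hrel hgens univ] := hY.
have hMt := is_Hmod_pmod true hM.
have pgen : pgeneric true (selP beta) zeta.
  case=> [[a b] k] _ ir pr nr; have h := hgen a b k ir pr nr.
  by split; apply/eqP => e; apply: h; [left|right; left|right; right].
have hct : true -> zeta.2 != 0 by [].
(* The universal property sends [one] to the nonzero invariant vector of the Dunkl model. *)
have one0 : one <> 0.
  move=> o0; have [U [MU [u [hU ru u0]]]] := relH_model hN hzeta.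
  have [f [lf _ f1]] := univ U MU u hU ru.
  by apply: u0; rewrite -f1 o0 (lin0 lf).
have hsp v : hspan true M one v.
  have sS := hspan_sub true M one; have [S0 SD SZ] := sS.
  elim: {v}(hgens v) => // [|u w _ hu _ hw|a u _ hu|x u _ hu|i u _ hu|u _ hu].
  - exact (hspan_one hMt).
  - exact: SD.
  - exact: SZ.
  - exact: (hspan_W hMt).
  - exact: (hspan_X hN hMt hrel).
  - by rewrite (hspan_C hN hMt hrel hu); apply: SZ.
have XP (x : W N) : in_X (selP beta) x <-> xcond beta x.
  by split; [exact: (in_X_xcond hN)|exact: (xcond_in_X hN)].
have hphi (x : W N) : xcond beta x -> Reach true zeta M one x (phi_red M (red x) one).
  move=> xc; apply: (Reach_red hN pgen one hM).
    exact: (xcond_minrep hN).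
  by apply: hred; apply/XP.
split=> [v|].
  have [s [m [_ Xs Bs ->]]] := fiber_sum hN hzeta pgen hct hM hrel hphi (hsp v).
  by exists s, m; split=> // x /Xs/XP.
split=> [s m us Xs Bs s0|].
  apply: (fiber_independent hN hzeta pgen hct hM hrel one0 hphi us _ Bs s0).
  by move=> x /Xs/XP.
split=> x /XP xc; first exact: (fiber_Birreducible hN hzeta pgen hct hM hrel one0 xc (hphi x xc)).
move=> Vb Bb oneb; exact: (fiber_iso hN hzeta pgen hct hM hrel one0 xc (hphi x xc)).
Qed.
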